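(* Let $\Phi$ be an NCIFS on $X\subset\mathbb R^d$ which is balanced and uniformly finite, and let $h=B(\Phi)$. Then the $h$-dimensional Hausdorff measure $\mathcal H_h(J(\Phi))$ is infinite, finite and positive, or zero, according to whether $\liminf_{n\to\infty}Z_n(h)$ is infinite, finite and positive, or zero, respectively.
   Context: Fix $d\in\mathbb N$ and a compact set $X\subset\mathbb R^d$ equal to the closure of its interior, such that $\partial X$ is smooth or $X$ is convex. $\|D\phi\|:=\sup_{x\in X}|\phi'(x)|$ for a conformal map $\phi$. An NCIFS $\Phi$ on $X$ is a sequence $\Phi^{(j)}=(\phi^{(j)}_i:X\to X)_{i\in I^{(j)}}$, $j\ge1$, of families indexed by finite or countably infinite sets, satisfying: - (open set condition) images of $\operatorname{int}X$ under distinct maps of the same $\Phi^{(j)}$ are disjoint; - (conformality) there is an open connected $V\supset X$ such that all maps extend to $C^1$ conformal diffeomorphisms of $V$ into $V$; - (bounded distortion) there is $K\ge1$ with $|\phi'(x)|\le K|\phi'(y)|$ for $x,y\in V$ and every composition $\phi^{(k)}_{\omega_k}\circ\cdots\circ\phi^{(l)}_{\omega_l}$; - (uniform contraction) $\|D\phi^{(j)}_i\|\le\eta<1$ for all $i,j$. Uniformly finite: there is $q\in\mathbb N$ with $\# I^{(n)}\le q$ for all $n$. Balanced: there is $\kappa\ge1$ with $\rho_n:=\max_{a,b\in I^{(n)}}\|D\phi^{(n)}_a\|/\|D\phi^{(n)}_b\|\le\kappa$ for all $n$. For $\omega\in I^n=\prod_{j\le n}I^{(j)}$ let $\phi_\omega=\phi^{(1)}_{\omega_1}\circ\cdots\circ\phi^{(n)}_{\omega_n}$.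 Define $J(\Phi)=\bigcap_n\bigcup_{\omega\in I^n}\phi_\omega(X)$, $Z_n(t)=\sum_{\omega\in I^n}\|D\phi_\omega\|^t$, $\underline P(t)=\liminf_n\frac1n\log Z_n(t)$ and $B(\Phi)=\sup\{t\ge0:\underline P(t)>0\}$ (with $\sup\emptyset=0$). *)

(* Defs.v *)
From HB Require Import structures.
From mathcomp Require Import all_boot all_order all_algebra.
From mathcomp Require Import all_classical all_reals all_analysis.
Set Implicit Arguments. Unset Strict Implicit. Unset Printing Implicit Defensive.
Import Order.TTheory GRing.Theory Num.Theory numFieldNormedType.Exports.
Local Open Scope classical_set_scope.
Local Open Scope ring_scope.

Section NCIFS.
Context {R : realType} {d : nat}.
Notation pt := 'rV[R]_d.

Definition enorm (x : pt) : R := Num.sqrt (\sum_(i < d) x ord0 i ^+ 2).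

Definition dnorm (f : pt -> pt) (x : pt) : R :=
  sup [set enorm ('d f x v) | v in [set v : pt | enorm v = 1]].

Definition Dnorm (X : set pt) (f : pt -> pt) : R := sup (dnorm f @` X).

Definition conformal_C1_on (V : set pt) (f : pt -> pt) : Prop :=
  [/\ {in V &, injective f}, f @` V `<=` V,
      (forall x, V x -> differentiable f x),
      (forall v x, V x -> {for x, continuous (fun y => 'd f y v)}) &
      (forall x, V x -> exists2 s : R, 0 < s &
          forall v, enorm ('d f x v) = s * enorm v)].

Definition iterD (vs : seq pt) (g : pt -> R) : pt -> R :=
  foldr (fun v h => 'D_v h) g vs.

Definition smooth_on (U : set pt) (g : pt -> R) : Prop :=
  (forall vs v x, U x -> derivable (iterD vs g) x v) /\
  (forall vs x, U x -> {for x, continuous (iterD vs g)}).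

Definition topo_boundary (X : set pt) : set pt := closure X `\` interior X.

Definition smooth_boundary (X : set pt) : Prop :=
  forall p, topo_boundary X p ->
    exists U : set pt, exists g : pt -> R,
      [/\ open U, U p, smooth_on U g,
          X `&` U = [set x | U x /\ g x <= 0] &
          forall x, U x -> exists v : pt, 'D_v g x != 0].

(** Compositions phi^{(k)}_{w_1} o phi^{(k+1)}_{w_2} o ... (stages are
    0-based: stage j here is the paper's Phi^{(j+1)}). *)
Fixpoint comp_from (phi : nat -> nat -> pt -> pt) (k : nat) (w : seq nat)
  : pt -> pt :=
  match w with
  | [::] => id
  | i :: w' => phi k i \o comp_from phi k.+1 w'
  end.

Definition valid_word (m : nat -> nat) (k : nat) (w : seq nat) : Prop :=
  forall j, (j < size w)%N -> (nth 0%N w j < m (k + j))%N.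

Fixpoint words (m : nat -> nat) (n : nat) : seq (seq nat) :=
  match n with
  | 0 => [:: [::]]
  | n'.+1 => [seq rcons w i | w <- words m n', i <- iota 0 (m n')]
  end.

Definition phi_word (phi : nat -> nat -> pt -> pt) (w : seq nat) := comp_from phi 0 w.

Definition Zn (X : set pt) (phi : nat -> nat -> pt -> pt) (m : nat -> nat)
    (n : nat) (t : R) : R :=
  \sum_(w <- words m n) powR (Dnorm X (phi_word phi w)) t.

Definition lowerP X phi m (t : R) : \bar R :=
  limn_einf (fun n => (ln (Zn X phi m n t) / n%:R)%:E).

(** B(Phi) = sup {t >= 0 : lowerP t > 0}  (sup set0 = 0 in MathComp). *)
Definition Bdim X phi m : R := sup [set t : R | 0 <= t /\ (0 < lowerP X phi m t)%E].

Definition limit_set X phi m : set pt :=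
  \bigcap_n \bigcup_(w in [set w | w \in words m n]) (phi_word phi w @` X).

Definition ediam (U : set pt) : \bar R :=
  ereal_sup [set (enorm (x - y))%:E | x in U & y in U].

Definition hcontent (h : R) (U : set pt) : \bar R :=
  if pselect (U = set0) then 0%E else (powR (fine (ediam U)) h)%:E.

Definition hausdorff_delta (h delta : R) (A : set pt) : \bar R :=
  ereal_inf [set (\sum_(0 <= k <oo) hcontent h (U k))%E |
    U in [set U : nat -> set pt |
           A `<=` \bigcup_k U k /\ forall k, (ediam (U k) <= delta%:E)%E]].

Definition hausdorff_measure (h : R) (A : set pt) : \bar R :=
  ereal_sup [set hausdorff_delta h delta A | delta in [set delta : R | 0 < delta]].

Definition admissible_X (X : set pt) : Prop :=
  [/\ X !=set0, compact X, X = closure (interior X) &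
      smooth_boundary X \/ convex_set (X : set (convex_lmodType pt))].

(** Phi is an NCIFS on X: stage j consists of the maps phi j i, i < m j. *)
Definition is_NCIFS (X : set pt) (phi : nat -> nat -> pt -> pt)
    (m : nat -> nat) : Prop :=
  [/\ (forall j, (0 < m j)%N),
      (forall j i, (i < m j)%N -> phi j i @` X `<=` X),
      (forall j a b, (a < m j)%N -> (b < m j)%N -> a != b ->
         phi j a @` interior X `&` phi j b @` interior X = set0),
      (exists V : set pt,
         [/\ open V, connected V, X `<=` V,
             (forall j i, (i < m j)%N -> conformal_C1_on V (phi j i)) &
             exists2 K : R, 1 <= K &
               forall k w, valid_word m k w -> w != [::] ->
               forall x y, V x -> V y ->
                 dnorm (comp_from phi k w) x <= K * dnorm (comp_from phi k w) y]) &
      (exists2 eta : R, eta < 1 &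
         forall j i, (i < m j)%N -> Dnorm X (phi j i) <= eta)].

Definition uniformly_finite (m : nat -> nat) : Prop :=
  exists q : nat, forall n, (m n <= q)%N.

Definition balanced (X : set pt) (phi : nat -> nat -> pt -> pt)
    (m : nat -> nat) : Prop :=
  exists2 kappa : R, 1 <= kappa &
    forall n a b, (a < m n)%N -> (b < m n)%N ->
      Dnorm X (phi n a) / Dnorm X (phi n b) <= kappa.

End NCIFS.

(* Main.v *)
(** Let D_w be the norm of the derivative of phi_w on X. Bounded distortion makes
    D almost multiplicative under concatenation of words and gives
    diam phi_w(X) <= C D_w, so the sets phi_w(X) with |w| = n show that
    H_h(J) <= C^h liminf Z_n(h). Conversely let Z_k(h) >= M for all large k, and
    give each word w of length n the mass D_w^h / Z_n(h). A set U of small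
    diameter r is met by the images of at most N words u that are minimal with
    D_u > r and some child of norm at most r: these words form an antichain, and
    since X contains a ball of radius comparable to s inside each s-ball
    centred in X, disjoint balls of radius comparable to r can be placed inside
    the sets phi_u(X) near U. By balancedness each of the at most q children of u
    has norm at most K kappa r, so U carries mass at most C r^h / M, uniformly
    in n. Since J is the intersection of the compact sets of level n, every
    countable cover of J can be thickened to a cover of some level, whence
    H_h(J) >= M / C. *)
Require Import Defs.
From HB Require Import structures.
From mathcomp Require Import all_boot all_order all_algebra.
From mathcomp Require Import all_classical all_reals all_analysis.
From mathcomp Require Import ring lra.
Import Order.TTheory GRing.Theory Num.Theory numFieldNormedType.Exports.
Local Open Scope classical_set_scope.
Local Open Scope ring_scope.
Set Implicit Arguments. Unset Strict Implicit. Unset Printing Implicit Defensive.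

(** * Comparison of the Euclidean norm with the sup norm *)

Section RowVectorNorms.
Context {R : realType} {d : nat}.
Notation pt := 'rV[R]_d.

Lemma ler_coord_norm (x : pt) i : `|x ord0 i| <= `|x|.
Proof.
rewrite [leRHS]/Num.Def.normr/= mx_normrE.
exact: (le_bigmax _ _ (ord0, i)).
Qed.

Lemma norm_rV_le (x : pt) (r : R) :
  0 <= r -> (forall i, `|x ord0 i| <= r) -> `|x| <= r.
Proof.
move=> r0 xr; rewrite /Num.Def.normr/= mx_normrE (bigmax_le _ r0)//= => -[i j] _.
by rewrite (ord1 i) xr.
Qed.

Lemma enorm_ge0 (x : pt) : 0 <= enorm x.
Proof. exact: sqrtr_ge0. Qed.

Lemma enorm_sq (x : pt) : enorm x ^+ 2 = \sum_(i < d) x ord0 i ^+ 2.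
Proof. by rewrite sqr_sqrtr//; apply: sumr_ge0 => i _; exact: sqr_ge0. Qed.

Lemma norm_le_enorm (x : pt) : `|x| <= enorm x.
Proof.
apply: norm_rV_le => [|i]; first exact: enorm_ge0.
rewrite -(ler_pXn2r (n := 2))// ?nnegrE ?enorm_ge0// enorm_sq real_normK ?num_real//.
by rewrite (bigD1 i)//= lerDl; apply: sumr_ge0 => j _; exact: sqr_ge0.
Qed.

Lemma enorm_le_norm (x : pt) : enorm x <= d%:R * `|x|.
Proof.
rewrite -(ler_pXn2r (n := 2))// ?nnegrE ?enorm_ge0 ?mulr_ge0// enorm_sq.
apply: (@le_trans _ _ (\sum_(i < d) `|x| ^+ 2)).
  apply: ler_sum => i _; rewrite -[leLHS]real_normK ?num_real//.
  by rewrite ler_pXn2r ?nnegrE// ler_coord_norm.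
rewrite sumr_const card_ord exprMn -[leLHS]mulr_natl.
apply: ler_wpM2r; first exact: exprn_ge0.
by rewrite -natrX ler_nat; case: (d) => // n; rewrite leq_pmulr.
Qed.

Lemma enormZ (a : R) (x : pt) : enorm (a *: x) = `|a| * enorm x.
Proof.
rewrite /enorm -sqrtr_sqr -sqrtrM ?sqr_ge0// mulr_sumr; congr Num.sqrt.
by apply: eq_bigr => i _; rewrite mxE exprMn.
Qed.

Lemma enorm_eq0 (x : pt) : enorm x = 0 -> x = 0.
Proof. by move=> x0; apply/eqP; rewrite -normr_le0 -x0 norm_le_enorm. Qed.

Lemma exists_unit_enorm : (0 < d)%N -> exists v : pt, enorm v = 1.
Proof.
move=> d0; pose e : pt := const_mx 1.
have e0 : 0 < enorm e.
  rewrite lt_neqAle enorm_ge0 andbT eq_sym; apply/eqP => /enorm_eq0/rowP.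
  by move=> /(_ (Ordinal d0)); rewrite !mxE => /eqP; rewrite oner_eq0.
exists ((enorm e)^-1 *: e); rewrite enormZ gtr0_norm ?invr_gt0// mulVf//.
by rewrite gt_eqF.
Qed.

End RowVectorNorms.

(** * The mean value theorem along a line *)

Section MeanValue.
Context {R : realType} {V : normedModType R}.

Lemma is_derive_line (g : V -> R) (x v : V) (t : R) :
  derivable g (x + t *: v) v ->
  is_derive t 1 (fun s => g (x + s *: v)) ('D_v g (x + t *: v)).
Proof.
move=> gv.
have E : (fun h => h^-1 *: (g (x + (h *: 1 + t) *: v) - g (x + t *: v))) =
         (fun h : R => h^-1 *: (g (h *: v + (x + t *: v)) - g (x + t *: v))).
  apply/funext => h; congr (_ *: (g _ - _)).
  by rewrite scalerDl [h *: 1]mulr1 addrCA.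
split; first by rewrite /derivable E.
by rewrite /derive E.
Qed.

Lemma MVT_line_itv (g : V -> R) (x v : V) (a b : R) : a < b ->
  (forall t : R, a <= t <= b -> derivable g (x + t *: v) v) ->
  exists2 t : R, a <= t <= b &
    g (x + b *: v) - g (x + a *: v) = 'D_v g (x + t *: v) * (b - a).
Proof.
move=> ab gv; pose phi (s : R) := g (x + s *: v).
have dphi (s : R) : a <= s <= b -> is_derive s 1 phi ('D_v g (x + s *: v)).
  by move=> s01; apply: is_derive_line; exact: gv.
have [s||c] := @MVT R phi (fun s => 'D_v g (x + s *: v)) a b ab.
- by rewrite in_itv/= => /andP[s0 s1]; apply: dphi; rewrite !ltW.
- by apply: derivable_within_continuous => s; rewrite in_itv/= => /dphi[].
- rewrite in_itv/= => /andP[c0 c1] E.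
  by exists c; rewrite ?(ltW c0) ?(ltW c1).
Qed.

Lemma MVT_line (g : V -> R) (x v : V) :
  (forall t : R, 0 <= t <= 1 -> derivable g (x + t *: v) v) ->
  exists2 t : R, 0 <= t <= 1 & g (x + v) - g x = 'D_v g (x + t *: v).
Proof.
move=> /(MVT_line_itv ltr01)[t t01].
by rewrite scale1r scale0r addr0 subr0 mulr1 => E; exists t.
Qed.

End MeanValue.

(** * Lipschitz estimates from a bound on the differential *)

Section BoundedDifferential.
Context {R : realType} {d : nat}.
Notation pt := 'rV[R]_d.

Definition diff_bound (f : pt -> pt) (M : R) (x : pt) : Prop :=
  differentiable f x /\ forall v, enorm ('d f x v) <= M * enorm v.

(** The mean value theorem is applied to each coordinate of [f] separately. The intermediate point
    varies with the coordinate, which is harmless because the left side is a sup norm. *)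
Lemma diff_bound_segment (f : pt -> pt) (M : R) (x y : pt) :
  (forall t : R, 0 <= t <= 1 -> diff_bound f M (x + t *: (y - x))) ->
  `|f y - f x| <= M * enorm (y - x).
Proof.
move=> fM; set v := y - x.
have xv : y = x + v by rewrite /v addrC subrK.
apply: norm_rV_le => [|i].
  have [_ /(_ v)] := fM 0 (ltac:(by rewrite lexx ler01)).
  by apply: le_trans; exact: enorm_ge0.
have gv (t : R) : 0 <= t <= 1 -> derivable (fun z => f z ord0 i) (x + t *: v) v.
  move=> /fM[df _]; have /derivable_mxP := @diff_derivable _ _ _ f _ v df.
  exact.
have [t t01] := MVT_line gv; rewrite -xv => E.
have [df fb] := fM t t01.
have -> : (f y - f x) ord0 i = ('d f (x + t *: v) v) ord0 i.
  rewrite !mxE E -deriveE// derive_mx ?mxE//; exact: diff_derivable.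
by apply: le_trans (fb v); apply: le_trans (norm_le_enorm _); exact: ler_coord_norm.
Qed.

Lemma ball_rVE (x : pt) (r : R) y : ball x r y <-> `|x - y| < r.
Proof. by rewrite -ball_normE. Qed.

Lemma diff_bound_ball (f : pt -> pt) (M r : R) (c x y : pt) :
  (forall z, ball c r z -> diff_bound f M z) -> ball c r x -> ball c r y ->
  `|f y - f x| <= M * enorm (y - x).
Proof.
move=> fM /ball_rVE cx /ball_rVE cy; apply: diff_bound_segment => t /andP[t0 t1].
apply: fM; apply/ball_rVE.
have -> : c - (x + t *: (y - x)) = (1 - t) *: (c - x) + t *: (c - y).
  by apply/rowP => i; rewrite !mxE; ring.
rewrite (le_lt_trans (ler_normD _ _))// !normrZ !ger0_norm ?subr_ge0//.
have [->|tn0] := eqVneq t 0; first by rewrite subr0 mul1r mul0r addr0.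
have tp : 0 < t by rewrite lt_neqAle eq_sym tn0.
have : (1 - t) * `|c - x| <= (1 - t) * r by rewrite ler_wpM2l ?subr_ge0// ltW.
have : t * `|c - y| < t * r by rewrite ltr_pM2l.
lra.
Qed.

End BoundedDifferential.

(** * A quantitative open mapping theorem *)

Section OpenMapping.
Context {R : realType} {d : nat}.
Notation pt := 'rV[R]_d.

Lemma norm_dist_continuous (x0 : pt) : continuous (fun x : pt => `|x - x0|).
Proof.
move=> x; have h : z - x0 @[z --> nbhs x] --> x - x0.
  by apply: cvgB; [exact: cvg_id|exact: cvg_cst].
exact: cvg_norm h.
Qed.

Lemma linear_inj_surj (A : {linear pt -> pt}) :
  (forall v, A v = 0 -> v = 0) -> forall u, exists v, A v = u.
Proof.
move=> A0 u; pose B := lin1_mx A.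
have BE v : A v = v *m B by rewrite mul_rV_lin1.
have : row_free B.
  rewrite -kermx_eq0; apply/eqP/row_matrixP => i; rewrite row0; apply: A0.
  by rewrite BE -row_mul mulmx_ker row0.
rewrite row_free_unit => Bu; exists (u *m invmx B).
by rewrite BE mulmxKV.
Qed.

(* Minimise |f x - y| + (a / 2d) |x - x0| over the closed ball. The minimiser is
   interior, and if f x <> y there, moving in the direction v with
   'd f x v = y - f x decreases the functional. *)
Lemma ball_subset_image (f : pt -> pt) (a r : R) (x0 : pt) :
  (0 < d)%N -> 0 < a -> 0 < r ->
  (forall x, `|x - x0| <= r ->
     differentiable f x /\ forall v, a * enorm v <= enorm ('d f x v)) ->
  ball (f x0) (a / (2 * d%:R) * r) `<=` f @` ball x0 r.
Proof.
move=> d0 a0 r0 fa y /ball_rVE; set c := a / (2 * d%:R) => fy.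
have dR : 0 < d%:R :> R by rewrite ltr0n.
have c0 : 0 < c by rewrite divr_gt0// mulr_gt0.
pose B : set pt := [set x | `|x - x0| <= r].
pose F (x : pt) := `|f x - y| + c * `|x - x0|.
have Bx0 : B x0 by rewrite /B/= subrr normr0 ltW.
have cB : compact B.
  apply: bounded_closed_compact.
    exists (`|x0| + r); split; first exact: num_real.
    move=> e er x /= Bx; rewrite (le_trans _ (ltW er))//.
    by rewrite -(subrK x0 x) addrC (le_trans (ler_normD _ _))// lerD.
  have -> : B = (fun x => `|x - x0|) @^-1` [set z : R | z <= r] by [].
  apply: closed_comp; last exact: closed_le.
  by move=> x _; exact: norm_dist_continuous.
have cF : {within B, continuous F}.
  apply: continuous_in_subspaceT => x /set_mem Bx.
  have df : f z - y @[z --> nbhs x] --> f x - y.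
    have [dfx _] := fa x Bx; apply: cvgB; last exact: cvg_cst.
    exact: differentiable_continuous dfx.
  apply: (cvgD (cvg_norm df)).
  by apply: cvgMr; exact: norm_dist_continuous.
have [xs /set_mem Bxs minF] := EVT_min_rV (ex_intro _ x0 Bx0) cB cF.
(* The penalty at [xs] is at most [F xs <= F x0 = |f x0 - y| < c * r], so the minimiser is
   interior. *)
have xsr : `|xs - x0| < r.
  have := minF x0 (mem_set Bx0).
  rewrite {2}/F subrr normr0 mulr0 addr0 /F => h.
  have : c * `|xs - x0| < c * r.
    by apply: le_lt_trans fy; apply: le_trans h; rewrite lerDr.
  by rewrite ltr_pM2l.
exists xs; first by apply/ball_rVE; rewrite distrC.
apply/eqP; rewrite -subr_eq0; apply/negPn/negP => wn0.
set w := f xs - y in wn0; have w0 : 0 < `|w| by rewrite normr_gt0.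
have [df dfa] := fa xs Bxs.
have [|v dv] := linear_inj_surj (A := 'd f xs) _ (- w).
  move=> v v0; apply: enorm_eq0; apply/eqP; rewrite eq_le enorm_ge0 andbT.
  have := dfa v; rewrite v0.
  have -> : enorm (0 : pt) = 0 by rewrite -(scale0r (0:pt)) enormZ normr0 mul0r.
  by rewrite pmulr_rle0.
(* From [a * |v| <= a * enorm v <= enorm w <= d * |w|]; the 2 in the denominator of [c] leaves half
   of [|w|] to spare. *)
have cv : c * `|v| <= `|w| / 2.
  have h1 := dfa v; rewrite dv in h1.
  have h2 : a * `|v| <= d%:R * `|w|.
    rewrite -(normrN w) (le_trans _ (enorm_le_norm _))// (le_trans _ h1)//.
    by rewrite ler_pM2l// norm_le_enorm.
  rewrite /c -(ler_pM2l dR).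
  have -> : d%:R * (a / (2 * d%:R) * `|v|) = (a * `|v|) / 2.
    by field; rewrite gt_eqF.
  by rewrite mulrA ler_pM2r.
have dvf := @diff_derivable _ _ _ f xs v df.
have /cvgrPdist_le /(_ (`|w| / 4)) : h^-1 *: (f (h *: v + xs) - f xs) @[h --> 0^'] --> - w.
  by rewrite -dv -deriveE//; exact: dvf.
have w4 : 0 < `|w| / 4 by rewrite divr_gt0.
move=> /(_ w4) nf.
have [e' e'0 vh] : exists2 e : R, 0 < e &
    forall h, h <= e -> h * `|v| <= r - `|xs - x0|.
  have xs0 : 0 < r - `|xs - x0| by rewrite subr_gt0.
  have [->|vn0] := eqVneq v 0.
    by exists 1 => // h _; rewrite normr0 mulr0 ltW.
  exists ((r - `|xs - x0|) / `|v|); first by rewrite divr_gt0 ?normr_gt0.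
  by move=> h; rewrite ler_pdivlMr ?normr_gt0.
(* Along a step [h] the first term of [F] drops by at least [3/4 * h * |w|] and the penalty grows by
   at most [h * |w| / 2], which contradicts minimality. *)
have [h [h0 h1 hw hr]] : exists h : R, [/\ 0 < h, h <= 1,
    `|- w - h^-1 *: (f (h *: v + xs) - f xs)| <= `|w| / 4 &
    h * `|v| <= r - `|xs - x0|].
  near (0 : R)^'+ => h; exists h; split.
  - by [].
  - near: h; exact: nbhs_right_le.
  - near: h; case: nf => e /= e0 He; exists e => //= z ze z0; apply: He => //.
    by rewrite gt_eqF.
  - by apply: vh; near: h; exact: nbhs_right_le.
have Bh : B (h *: v + xs).
  rewrite /B/= -addrA (le_trans (ler_normD _ _))// normrZ gtr0_norm//.
  by rewrite -lerBrDr.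
have := minF _ (mem_set Bh); apply/negP; rewrite -ltNge /F.
set u := f (h *: v + xs) in hw *.
have e1 : `|u - y| <= (1 - h) * `|w| + h * (`|w| / 4).
  have -> : u - y = (1 - h) *: w - h *: (- w - h^-1 *: (u - f xs)).
    by apply/rowP => i; rewrite /w !mxE; field; rewrite gt_eqF.
  rewrite (le_trans (ler_normB _ _))// !normrZ (gtr0_norm h0).
  by rewrite ger0_norm ?subr_ge0// lerD2l ler_pM2l.
have e2 : `|h *: v + xs - x0| <= h * `|v| + `|xs - x0|.
  by rewrite -addrA (le_trans (ler_normD _ _))// normrZ gtr0_norm.
have e3 : c * `|h *: v + xs - x0| <= h * (`|w| / 2) + c * `|xs - x0|.
  rewrite (le_trans (ler_wpM2l (ltW c0) e2))// mulrDr lerD2r mulrCA.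
  by rewrite ler_pM2l.
have : 0 < h * `|w| by rewrite mulr_gt0.
rewrite -/w; lra.
Unshelve. all: by end_near. Qed.

End OpenMapping.

(** * Derivative norms of conformal maps and bounded distortion *)

Section ConformalMaps.
Context {R : realType} {d : nat}.
Notation pt := 'rV[R]_d.
Hypothesis d0 : (0 < d)%N.

Definition conformal_map (V : set pt) (f : pt -> pt) : Prop :=
  [/\ {in V &, injective f}, f @` V `<=` V,
      (forall x, V x -> differentiable f x) &
      (forall x, V x -> exists2 s : R, 0 < s &
          forall v, enorm ('d f x v) = s * enorm v)].

(** In positive dimension a unit vector exists, so the supremum is taken over the singleton [s] and
    not over the empty set. *)
Lemma dnorm_eq (f : pt -> pt) (x : pt) (s : R) :
  (forall v, enorm ('d f x v) = s * enorm v) -> dnorm f x = s.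
Proof.
move=> fs; rewrite /dnorm.
have -> : [set enorm ('d f x v) | v in [set v : pt | enorm v = 1]] = [set s].
  apply/seteqP; split => [_ [v /= v1 <-]|_ ->] /=; first by rewrite fs v1 mulr1.
  by have [v v1] := exists_unit_enorm (R := R) d0; exists v; rewrite // fs v1 mulr1.
exact: sup1.
Qed.

Lemma conformal_dnorm V f x : conformal_map V f -> V x ->
  0 < dnorm f x /\ forall v, enorm ('d f x v) = dnorm f x * enorm v.
Proof. by move=> [_ _ _ cf] /cf[s s0 fs]; rewrite (dnorm_eq fs). Qed.

Lemma conformal_id V : conformal_map V id.
Proof.
split=> //; first by rewrite image_id.
by move=> x Vx; exists 1 => // v; rewrite mul1r diff_val.
Qed.

Lemma dnorm_id x : dnorm (id : pt -> pt) x = 1.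
Proof. by apply: dnorm_eq => v; rewrite mul1r diff_val. Qed.

Lemma conformal_comp V f g :
  conformal_map V f -> conformal_map V g -> conformal_map V (f \o g).
Proof.
move=> cf cg; have [fi fV df _] := cf; have [gi gV dg _] := cg.
have gV' x : V x -> V (g x) by move=> Vx; apply: gV; exists x.
split.
- move=> x y /set_mem Vx /set_mem Vy /fi; rewrite !inE => /(_ (gV' _ Vx) (gV' _ Vy)).
  by apply: gi; rewrite inE.
- by move=> _ [x Vx <-]; apply: fV; exists (g x) => //; exact: gV'.
- by move=> x Vx; apply: differentiable_comp; [exact: dg|exact/df/gV'].
- move=> x Vx; have [f0 fd] := conformal_dnorm cf (gV' _ Vx).
  have [g0 gd] := conformal_dnorm cg Vx.
  move: (dnorm f (g x)) (dnorm g x) f0 fd g0 gd => a b a0 fd b0 gd.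
  exists (a * b); first by rewrite mulr_gt0.
  move=> v; rewrite diff_comp; [|exact: dg|exact/df/gV'].
  by rewrite /= fd gd mulrA.
Qed.

Lemma dnorm_comp V f g x : conformal_map V f -> conformal_map V g -> V x ->
  dnorm (f \o g) x = dnorm f (g x) * dnorm g x.
Proof.
move=> cf cg Vx; have [_ _ df _] := cf; have [_ gV dg _] := cg.
have Vgx : V (g x) by apply: gV; exists x.
have [_ fd] := conformal_dnorm cf Vgx.
have [_ gd] := conformal_dnorm cg Vx.
apply: dnorm_eq => v; rewrite diff_comp; [|exact: dg|exact: df].
by rewrite /= fd gd mulrA.
Qed.

Section Distortion.
Context (X V : set pt) (K : R).
Hypotheses (X0 : X !=set0) (XV : X `<=` V) (K1 : 1 <= K).

Definition distortion (f : pt -> pt) : Prop :=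
  forall x y, V x -> V y -> dnorm f x <= K * dnorm f y.

(** Distortion supplies the upper bound that makes [sup] a genuine supremum. *)
Lemma dnorm_le_Dnorm f x : distortion f -> X x -> dnorm f x <= Dnorm X f.
Proof.
move=> fK Xx; apply: ub_le_sup; last by exists x.
by exists (K * dnorm f x) => _ [y Xy <-]; apply: fK; exact: XV.
Qed.

Lemma Dnorm_le f c : (forall x, X x -> dnorm f x <= c) -> Dnorm X f <= c.
Proof.
move=> fc; apply: ge_sup; first by have [x Xx] := X0; exists (dnorm f x), x.
by move=> _ [x Xx <-]; exact: fc.
Qed.

Lemma dnorm_le_KDnorm f x : distortion f -> V x -> dnorm f x <= K * Dnorm X f.
Proof.
move=> fK Vx; have [y Xy] := X0; apply: le_trans (fK _ y Vx (XV Xy)) _.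
by rewrite ler_wpM2l ?(le_trans ler01)// dnorm_le_Dnorm.
Qed.

Lemma Dnorm_le_Kdnorm f x : distortion f -> V x -> Dnorm X f <= K * dnorm f x.
Proof. by move=> fK Vx; apply: Dnorm_le => y /XV Vy; exact: fK. Qed.

Lemma Dnorm_gt0 f : conformal_map V f -> distortion f -> 0 < Dnorm X f.
Proof.
move=> cf fK; have [x Xx] := X0.
by have [+ _] := conformal_dnorm cf (XV Xx) => /lt_le_trans; apply; exact: dnorm_le_Dnorm.
Qed.

Lemma Dnorm_comp_le f g : conformal_map V f -> conformal_map V g ->
  distortion f -> distortion g -> g @` X `<=` X ->
  Dnorm X (f \o g) <= Dnorm X f * Dnorm X g.
Proof.
move=> cf cg fK gK gX; apply: Dnorm_le => x Xx.
have Vx := XV Xx; have Xgx : X (g x) by apply: gX; exists x.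
rewrite (dnorm_comp cf cg Vx); apply: ler_pM; rewrite ?dnorm_le_Dnorm//.
- by have [/ltW] := conformal_dnorm cf (XV Xgx).
- by have [/ltW] := conformal_dnorm cg Vx.
Qed.

(** For conformal maps the chain rule is an equality of norms. Distortion replaces the norm of [f]
    over [X] by its derivative at [g x], at the cost of [K]; then the supremum over [x] is taken. *)
Lemma Dnorm_comp_ge f g : conformal_map V f -> conformal_map V g ->
  distortion f -> distortion (f \o g) -> g @` X `<=` X ->
  Dnorm X f * Dnorm X g <= K * Dnorm X (f \o g).
Proof.
move=> cf cg fK fgK gX.
rewrite -ler_pdivlMl ?Dnorm_gt0//; apply: Dnorm_le => x Xx.
have Vx := XV Xx; have Xgx : X (g x) by apply: gX; exists x.
rewrite ler_pdivlMl ?Dnorm_gt0//.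
have [g0 _] := conformal_dnorm cg Vx.
apply: (@le_trans _ _ (K * dnorm (f \o g) x)).
  rewrite (dnorm_comp cf cg Vx) mulrA ler_pM2r//.
  by apply: Dnorm_le_Kdnorm => //; exact: XV.
by rewrite ler_wpM2l ?(le_trans ler01)// dnorm_le_Dnorm.
Qed.

End Distortion.
End ConformalMaps.

(** * Words and their concatenation *)

Section Words.
Implicit Types (m : nat -> nat) (u v w : seq nat) (k n : nat).

Lemma valid_word_cat m k u v :
  valid_word m k (u ++ v) <-> valid_word m k u /\ valid_word m (k + size u) v.
Proof.
split=> [uv|[hu hv] j]; first split=> j jl.
- by have := uv j; rewrite size_cat nth_cat jl; apply; rewrite ltn_addr.
- have := uv (size u + j)%N; rewrite size_cat ltn_add2l => /(_ jl).
  by rewrite nth_cat [(_ < size u)%N]ltnNge leq_addr/= addKn addnA.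
- rewrite size_cat nth_cat; case: (ltnP j (size u)) => [jl _|jl ju]; first exact: hu.
  have := hv (j - size u)%N; rewrite -addnA subnKC//; apply.
  by rewrite ltn_subLR.
Qed.

Lemma valid_word_rcons m k w i :
  valid_word m k (rcons w i) <-> valid_word m k w /\ (i < m (k + size w))%N.
Proof.
rewrite -cats1 valid_word_cat; split=> -[hw hi]; split=> //.
  by have := hi 0%N isT; rewrite addn0.
by case=> //=; rewrite addn0.
Qed.

(** [words] always starts at stage 0, so words that start at stage [k] are enumerated through the
    shifted alphabet sizes. *)
Lemma mem_words m k n w :
  w \in words (fun j => m (k + j)%N) n <-> size w = n /\ valid_word m k w.
Proof.
elim: n w => [|n IH] w /=.
  rewrite inE; split=> [/eqP->|[/size0nil->]//]; split=> //.
split=> [/allpairsP[[v i] /= [vn im ->]]|].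
  have [sv vv] := (IH v).1 vn; rewrite size_rcons sv; split=> //.
  by apply/valid_word_rcons; rewrite sv; split=> //; rewrite mem_iota in im.
case/lastP: w => [[]//|w i]; rewrite size_rcons => -[[sw]] /valid_word_rcons[vw im].
apply/allpairsP; exists (w, i); split=> //=; first exact/IH.
by rewrite mem_iota -sw.
Qed.

Lemma words_uniq m n : uniq (words m n).
Proof.
elim: n => //= n IH; apply: allpairs_uniq => //; first exact: iota_uniq.
by move=> [u i] [v j] _ _ /= /rcons_inj[-> ->].
Qed.

Lemma sum_words_cat (R : realType) m j l (F : seq nat -> R) :
  \sum_(w <- words m (j + l)) F w =
  \sum_(u <- words m j) \sum_(v <- words (fun i => m (j + i)%N) l) F (u ++ v).
Proof.
elim: l F => [|l IH] F.
  by rewrite addn0; apply: eq_bigr => u _; rewrite /= big_seq1 cats0.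
rewrite addnS /= big_allpairs_dep IH; apply: eq_bigr => u _.
rewrite big_allpairs_dep; apply: eq_bigr => v _; apply: eq_bigr => i _.
by rewrite rcons_cat.
Qed.

End Words.

(** * Packing of separated points in a ball *)

Section Packing.
Context {R : realType} {d : nat}.
Notation pt := 'rV[R]_d.

Lemma truncn_eq_dist (a b : R) :
  0 <= a -> 0 <= b -> Num.truncn a = Num.truncn b -> `|a - b| <= 1.
Proof.
move=> /truncn_itv/andP[a1 a2] /truncn_itv/andP[b1 b2] E.
rewrite E in a1 a2; move: a2 b2; rewrite -!natr1 => a2 b2.
rewrite ler_norml; apply/andP; split; lra.
Qed.

(* Pigeonhole on a cubic grid. *)
Lemma packing_bound (c : R) : 0 < c -> exists N : nat,
  forall (T : eqType) (s : seq T) (p : T -> pt) (o : pt) (r : R),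
  0 < r -> uniq s -> (forall u, u \in s -> `|p u - o| <= r) ->
  (forall u v, u \in s -> v \in s -> u != v -> c * r <= `|p u - p v|) ->
  (size s <= N)%N.
Proof.
move=> c0; pose G := Num.truncn (4 / c).
exists #|{ffun 'I_d -> 'I_G.+1}| => T s p o r r0 us sr sep.
have cr0 : 0 < c * r / 2 by rewrite divr_gt0// mulr_gt0.
(* Coordinates measured from the corner [o - r] in cells of side [c * r / 2]: they lie in
   [[0, 4 / c]], and two points in one cell are closer than [c * r]. *)
pose x u (i : 'I_d) := (p u ord0 i - o ord0 i + r) / (c * r / 2).
have x_itv u i : u \in s -> 0 <= x u i <= 4 / c.
  move=> us'; have := le_trans (ler_coord_norm (p u - o) i) (sr _ us').
  rewrite !mxE ler_norml => /andP[l1 l2]; apply/andP; split.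
    by apply: divr_ge0; [lra|exact: ltW].
  rewrite /x ler_pdivrMr//.
  have -> : 4 / c * (c * r / 2) = 2 * r by field; rewrite gt_eqF.
  lra.
pose grid u : {ffun 'I_d -> 'I_G.+1} := [ffun i => inord (Num.truncn (x u i))].
rewrite -(size_map grid).
have um : uniq (map grid s).
  rewrite map_inj_in_uniq// => u v us' vs' E; apply/eqP/negPn/negP => uv.
  have := sep _ _ us' vs' uv; apply/negP; rewrite -ltNge.
  apply: (@le_lt_trans _ _ (c * r / 2)); last first.
    by rewrite ltr_pdivrMr// ltr_pMr ?mulr_gt0// ltr1n.
  apply: norm_rV_le => [|i]; first exact: ltW.
  have /andP[u0 u1] := x_itv u i us'; have /andP[v0 v1] := x_itv v i vs'.
  have tE : Num.truncn (x u i) = Num.truncn (x v i).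
    have /ffunP/(_ i) := E; rewrite !ffunE => /(congr1 val)/=.
    by rewrite !inordK// ltnS; apply: le_truncn.
  have := truncn_eq_dist u0 v0 tE; rewrite /x -mulrBl normrM.
  rewrite (@gtr0_norm _ (_^-1)) ?invr_gt0// ler_pdivrMr// mul1r !mxE.
  by apply: le_trans; rewrite opprD addrACA subrr addr0 opprB addrA subrK.
by rewrite -(card_uniqP um); exact: max_card.
Qed.

End Packing.

(** * Interior balls at every small scale *)

Section Corkscrew.
Context {R : realType} {d : nat}.
Notation pt := 'rV[R]_d.

(** Passage from local to uniform constants: a property that improves as [e] shrinks and holds near
    each point with some [e] holds on a compact set with a single [e]. *)
Lemma compact_uniform (A : set pt) (P : R -> pt -> Prop) : compact A ->
  (forall e e' x, 0 < e' <= e -> P e x -> P e' x) ->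
  (forall p, A p -> exists2 e : R, 0 < e & forall x, A x -> `|x - p| < e -> P e x) ->
  exists2 e : R, 0 < e & forall x, A x -> P e x.
Proof.
move=> /compact_near_coveringP cA Pmono Ploc.
have := cA R (0^'+) (fun e x => A x -> P e x) _; case.
  move=> p /Ploc[e e0 Pe]; exists (ball p e, [set e' | 0 < e' <= e]).
    split; first exact: nbhsx_ballx.
    near=> e'; apply/andP; split => //.
    near: e'; exact: nbhs_right_le.
  move=> [x e'] /= [/ball_rVE xp e'e] Ax.
  by apply: Pmono e'e _; apply: Pe => //; rewrite distrC.
move=> e /= e0 AP; exists (e / 2) => [|x Ax]; first by rewrite divr_gt0.
have e2 : 0 < e / 2 by rewrite divr_gt0.
have /(_ _ Ax) := AP (e / 2) _ e2 x; apply.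
by rewrite /= sub0r normrN gtr0_norm// ltr_pdivrMr// ltr_pMr// ltr1n.
Unshelve. all: by end_near. Qed.

(** The interior corkscrew condition of geometric analysis. One constant is both the largest scale
    and the ratio of radii, so that the condition is monotone in [e]. *)
Definition corkscrew (X : set pt) (e : R) (x : pt) : Prop :=
  forall r, 0 < r <= e ->
    exists2 z, `|z - x| <= r & ball z (e * r) `<=` X.

Lemma corkscrew_mono X e e' x :
  0 < e' <= e -> corkscrew X e x -> corkscrew X e' x.
Proof.
move=> /andP[e'0 e'e] cX r /andP[r0 re'].
have [|z zx zX] := cX r; first by rewrite r0 (le_trans re').
exists z => //; apply: subset_trans zX; apply: le_ball.
by rewrite ler_wpM2r// ltW.
Qed.

Lemma corkscrew_interior X p : interior X p ->
  exists2 e : R, 0 < e & forall x, X x -> `|x - p| < e -> corkscrew X e x.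
Proof.
rewrite /interior/= -nbhs_ballE => -[rho /= rho0 pX].
pose e := Num.min (rho / 2) 1.
have e0 : 0 < e by rewrite lt_min ltr01 divr_gt0.
have er : e <= rho / 2 by rewrite ge_min lexx.
have e1 : e <= 1 by rewrite ge_min lexx orbT.
exists e => // x _ xp r /andP[r0 re]; exists x; first by rewrite subrr normr0 ltW.
move=> y /ball_rVE xy; apply: pX; apply/ball_rVE.
have -> : p - y = (x - y) - (x - p) by rewrite opprB [RHS]addrC addrA subrK.
rewrite (le_lt_trans (ler_normB _ _))//.
have : e * r <= e by rewrite ler_piMr// ?(ltW e0)// (le_trans re).
lra.
Qed.

(** The homothety with centre [x] and ratio [r / M] maps a fixed ball inside [X] to a ball of radius
    comparable to [r], which stays in [X] by convexity. *)
Lemma corkscrew_convex X : compact X -> X !=set0 -> interior X !=set0 ->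
  convex_set (X : set (convex_lmodType pt)) ->
  exists2 e : R, 0 < e & forall x, X x -> corkscrew X e x.
Proof.
move=> cX _ [z0]; rewrite /interior/= -nbhs_ballE => -[rho /= rho0 pX] conv.
have Xz0 : X z0 by apply: pX; exact: ballxx.
have [M M0 XM] : exists2 M : R, 0 < M & forall x, X x -> `|x - z0| <= M.
  have [M [_ /(_ (`|M| + 1))]] := compact_bounded cX.
  rewrite (le_lt_trans (ler_norm M)) ?ltrDl// => /(_ isT) h.
  exists (`|M| + 1 + `|z0|).
    by rewrite -addrA addrCA ltr_wpDr// addr_ge0.
  by move=> x /h /= xM; rewrite (le_trans (ler_normB _ _))// lerD2r.
pose e := Num.min (rho / M) M.
have e0 : 0 < e by rewrite lt_min M0 divr_gt0.
have er : e <= rho / M by rewrite ge_min lexx.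
have eM : e <= M by rewrite ge_min lexx orbT.
exists e => // x Xx r /andP[r0 re].
have t0 : 0 < r / M by rewrite divr_gt0.
have t1 : r / M <= 1 by rewrite ler_pdivrMr// mul1r (le_trans re).
set t := r / M in t0 t1.
exists (x + t *: (z0 - x)).
  rewrite addrAC subrr add0r normrZ gtr0_norm// distrC.
  rewrite (le_trans (ler_wpM2l (ltW t0) (XM _ Xx)))// /t divfK// gt_eqF//.
move=> y /ball_rVE zy.
(* The preimage of [y] under the homothety is [z0 + w], that is,
   [y = t * (z0 + w) + (1 - t) * x]. *)
pose w := t^-1 *: (y - (x + t *: (z0 - x))).
have Xw : X (z0 + w).
  apply: pX; apply/ball_rVE; rewrite opprD addrA subrr sub0r normrN /w normrZ.
  rewrite gtr0_norm ?invr_gt0// mulrC ltr_pdivrMr// distrC.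
  apply: lt_le_trans zy _; rewrite /t mulrA mulrAC ler_pM2r//.
have := conv (z0 + w) x (Itv01 (ltW t0) t1) (mem_set Xw) (mem_set Xx).
move=> /set_mem; congr (X _).
rewrite /conv/= /w; apply/rowP => i; rewrite !mxE/= /unstable.onem; field.
by rewrite gt_eqF.
Qed.

(** The increment is walked one coordinate at a time, so that bounds on the partial derivatives
    suffice; each of the [d] moves costs at most [L * |w|]. *)
Lemma gradient_bound (g : pt -> R) (p : pt) (rho L : R) :
  (forall i y, `|y - p| < rho -> derivable g y (delta_mx ord0 i)) ->
  (forall i y, `|y - p| < rho -> `|'D_(delta_mx ord0 i) g y| <= L) ->
  forall y w, `|y - p| + `|w| < rho -> `|g (y + w) - g y| <= d%:R * (L * `|w|).
Proof.
move=> dg gL y w yw.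
(* The point [y] moved by [w] in the coordinates listed in [s] only; a repeated index changes
   nothing. *)
pose ys (s : seq 'I_d) : pt := \row_i (y ord0 i + (if i \in s then w ord0 i else 0)).
have near_y (z : pt) : (forall i, `|(z - y) ord0 i| <= `|w|) -> `|z - p| < rho.
  move=> zy; apply: le_lt_trans yw.
  rewrite -(subrK y z) -addrA addrC (le_trans (ler_normD _ _))// lerD2l.
  exact: norm_rV_le.
have ind s : `|g (ys s) - g y| <= (size s)%:R * (L * `|w|).
  elim: s => [|i s IH].
    have -> : ys [::] = y by apply/rowP => i; rewrite !mxE addr0.
    by rewrite subrr normr0 mul0r.
  have L0 : 0 <= L * `|w|.
    rewrite mulr_ge0//; apply: le_trans (gL i y _) => //.
    by apply: le_lt_trans yw; rewrite lerDl.
  have [is_s|is_s] := boolP (i \in s).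
    have -> : ys (i :: s) = ys s.
      by apply/rowP => j; rewrite !mxE inE; case: eqP => // ->; rewrite is_s.
    by apply: le_trans IH _; rewrite ler_wpM2r// ler_nat.
  have E : ys (i :: s) = ys s + w ord0 i *: delta_mx ord0 i.
    apply/rowP => j; rewrite !mxE inE eqxx/=; case: eqVneq => [->|_] /=.
      by rewrite (negbTE is_s) addr0 mulr1.
    by rewrite mulr0 addr0.
  have step : `|g (ys (i :: s)) - g (ys s)| <= L * `|w|.
    have seg (t : R) : `|t| <= `|w ord0 i| ->
        `|ys s + t *: delta_mx ord0 i - p| < rho.
      move=> tw; apply: near_y => j; rewrite !mxE eqxx/=.
      have [->|_] := eqVneq j i.
        rewrite (negbTE is_s) addr0 mulr1 addrAC subrr add0r (le_trans tw)//.
        exact: ler_coord_norm.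
      rewrite mulr0 addr0 addrAC subrr add0r.
      by case: ifP => _; rewrite ?normr0// ler_coord_norm.
    have bnd (t : R) : `|t| <= `|w ord0 i| ->
        `|'D_(delta_mx ord0 i) g (ys s + t *: delta_mx ord0 i)| * `|w ord0 i|
        <= L * `|w|.
      move=> tw; apply: ler_pM => //; last exact: ler_coord_norm.
      by apply: gL; exact: seg.
    rewrite E; have [w0|w0|->] := ltrgtP (w ord0 i) 0.
    - have [t /andP[t1 t2]|t /andP[t1 t2]] :=
        @MVT_line_itv _ _ g (ys s) (delta_mx ord0 i) _ _ w0.
        by apply: dg; apply: seg; rewrite !ler0_norm ?lerN2// ltW.
      rewrite scale0r addr0 => h; rewrite distrC h sub0r normrM normrN.
      by apply: bnd; rewrite !ler0_norm ?lerN2// ltW.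
    - have [t /andP[t1 t2]|t /andP[t1 t2]] :=
        @MVT_line_itv _ _ g (ys s) (delta_mx ord0 i) _ _ w0.
        by apply: dg; apply: seg; rewrite !ger0_norm// ltW.
      rewrite scale0r addr0 => h; rewrite h subr0 normrM.
      by apply: bnd; rewrite !ger0_norm// ltW.
    - by rewrite scale0r addr0 subrr normr0.
  rewrite /= -natr1 mulrDl mul1r [leRHS]addrC.
  by rewrite (le_trans (ler_distD (g (ys s)) _ _))// lerD.
have -> : y + w = ys (enum 'I_d) by apply/rowP => i; rewrite !mxE mem_enum.
by have := ind (enum 'I_d); rewrite size_enum_ord.
Qed.

(** The direction is [v] or [- v] according to the sign of the derivative at [p]. By continuity the
    derivative keeps at least half its size nearby, and this half is the rate [c]. *)
Lemma descent_direction (U : set pt) (g : pt -> R) (p : pt) :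
  open U -> U p -> smooth_on U g -> (exists v, 'D_v g p != 0) ->
  exists u : pt, exists c : R, exists rho : R,
    [/\ 0 < c, 0 < rho, ball p rho `<=` U &
      forall y (t : R), 0 <= t -> `|y - p| + t * `|u| < rho ->
        g (y + t *: u) <= g y - c * t].
Proof.
move=> oU Up [gd gc] [v vp].
have : \forall y \near p, U y by exact: open_nbhs_nbhs.
have cv := gc [:: v] p Up.
pose c := `|'D_v g p| / 2; have c0 : 0 < c by rewrite divr_gt0 ?normr_gt0.
move/cvgrPdist_lt : cv => /(_ _ c0) n1 n2.
have : nbhs p (U `&` [set y | `|'D_v g p - 'D_v g y| < c]) by exact: filterI n2 n1.
rewrite -nbhs_ballE => -[rho /= rho0 pr].
have sep y : `|y - p| < rho -> U y /\ `|'D_v g p - 'D_v g y| < c.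
  move=> yp; have yb : ball p rho y by apply/ball_rVE; rewrite distrC.
  exact: pr y yb.
have line (y : pt) (s t : R) : `|y - p| + t * `|v| < rho -> `|s| <= t ->
    `|y + s *: v - p| < rho.
  move=> yt st; rewrite addrAC (le_lt_trans (ler_normD _ _))//.
  apply: le_lt_trans yt; rewrite lerD2l normrZ.
  by rewrite ler_wpM2r.
have bU : ball p rho `<=` U.
  by move=> y /ball_rVE; rewrite distrC => /sep[].
have [vn|vpos|v0] := ltrgtP ('D_v g p) 0; last by rewrite v0 eqxx in vp.
- exists v, c, rho; split=> // y t; rewrite le_eqVlt => /predU1P[<- _|t0 yt].
    by rewrite scale0r mulr0 addr0 subr0.
  have [s /andP[s0 st]|s /andP[s0 st]] := @MVT_line_itv _ _ g y v _ _ t0.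
    have [Us _] := sep _ (line _ s _ yt (ltac:(by rewrite ger0_norm))).
    exact: (gd [::]).
  have [_] := sep _ (line _ s _ yt (ltac:(by rewrite ger0_norm))).
  rewrite scale0r addr0 subr0 ltr_norml => /andP[h1 _] h2.
  have h3 : 'D_v g (y + s *: v) <= - c.
    by move: h1; rewrite /c ltr0_norm//; lra.
  have := ler_wpM2r (ltW t0) h3; lra.
- exists (- v), c, rho; split=> // y t; rewrite normrN le_eqVlt => /predU1P[<- _|t0 yt].
    by rewrite scale0r mulr0 addr0 subr0.
  have nt0 : - t < 0 by rewrite oppr_lt0.
  (* The move along [- v] is read as the interval from [- t] to 0 along [v], so that only the
     derivative along [v] occurs. *)
  have [s /andP[s0 st]|s /andP[s0 st]] := @MVT_line_itv _ _ g y v _ _ nt0.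
    have [Us _] := sep _ (line _ s _ yt (ltac:(by rewrite ler0_norm// lerNl))).
    exact: (gd [::]).
  have [_] := sep _ (line _ s _ yt (ltac:(by rewrite ler0_norm// lerNl))).
  rewrite scale0r addr0 sub0r opprK scaleNr scalerN ltr_norml => /andP[_ h1] h2.
  have h3 : c <= 'D_v g (y + s *: v).
    by move: h1; rewrite /c gtr0_norm//; lra.
  have := ler_wpM2r (ltW t0) h3; lra.
Qed.

(** From [x], where [g x <= 0], a move of length at most [r] in the descent direction lowers [g] by
    [c * t]. On a ball of radius [e * r] about the new point [g] varies by no more than that, so the
    ball stays in [X]. *)
Lemma corkscrew_smooth X p : closed X -> smooth_boundary X -> topo_boundary X p ->
  exists2 e : R, 0 < e & forall x, X x -> `|x - p| < e -> corkscrew X e x.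
Proof.
move=> clX sX bp; have [U [g [oU Up gs XU gv]]] := sX p bp.
have [u [c [rho [c0 rho0 pU desc]]]] := descent_direction oU Up gs (gv p Up).
have [gd gc] := gs.
have [L [rho' [L0 rho'0 rr' gL]]] : exists L : R, exists rho' : R,
    [/\ 0 < L, 0 < rho', rho' <= rho & forall i y, `|y - p| < rho' ->
      `|'D_(delta_mx ord0 i) g y| <= L].
  pose L := \sum_(i < d) `|'D_(delta_mx ord0 i) g p| + 1.
  have L0 : 0 < L by rewrite ltr_wpDl// sumr_ge0.
  have : nbhs p [set y | forall i : 'I_d, `|'D_(delta_mx ord0 i) g y| <= L].
    apply: (@filter_forall _ _
      (fun i : 'I_d => [set y | `|'D_(delta_mx ord0 i) g y| <= L]) (nbhs p)) => i.
    have := gc [:: delta_mx ord0 i] p Up; rewrite /=.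
    move/cvgrPdist_lt => /(_ _ ltr01); apply: filterS => y h.
    have := ler_normD ('D_(delta_mx ord0 i) g y - 'D_(delta_mx ord0 i) g p)
                      ('D_(delta_mx ord0 i) g p).
    rewrite subrK => /le_trans; apply; rewrite distrC addrC lerD ?(ltW h)//.
    by rewrite (bigD1 i)//= lerDl sumr_ge0.
  rewrite -nbhs_ballE => -[r1 /= r10 h].
  exists L, (Num.min r1 rho); split=> //; first by rewrite lt_min r10.
    by rewrite ge_min lexx orbT.
  move=> i y; rewrite lt_min => /andP[yp _]; apply: h; apply/ball_rVE.
  by rewrite distrC.
pose a := 1 + `|u|; have a0 : 0 < a by rewrite ltr_wpDr.
pose b := d%:R * L + 1; have b0 : 0 < b by rewrite ltr_wpDl// mulr_ge0// ltW.
(* The bound [rho' / 8] keeps every point involved within [rho'] of [p]; the last bound gives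
   [b * (e * r) <= c * t] for [t = r / a], where [a] ensures [t * |u| <= r]. *)
pose e := Num.min 1 (Num.min (rho' / 8) (c / (a * b))).
have e0 : 0 < e by rewrite !lt_min ltr01 !divr_gt0// mulr_gt0.
have e1 : e <= 1 by rewrite ge_min lexx.
have e2 : e <= rho' / 8 by rewrite !ge_min lexx orbT.
have e3 : e <= c / (a * b) by rewrite !ge_min lexx !orbT.
exists e => // x Xx xp r /andP[r0 re].
pose t := r / a; have t0 : 0 < t by rewrite divr_gt0.
have tu : t * `|u| <= r.
  rewrite /t mulrAC ler_pdivrMr// ler_pM2l// /a lerDr//.
have Ux : U x by apply: pU; apply/ball_rVE; rewrite distrC; lra.
have gx : g x <= 0.
  by have : (X `&` U) x by []; rewrite XU => -[].
exists (x + t *: u).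
  by rewrite addrAC subrr add0r normrZ (gtr0_norm t0).
move=> y /ball_rVE zy.
have er : e * r <= rho' / 8 by rewrite (le_trans _ e2)// ler_piMr ?(le_trans re)// ltW.
have zp : `|x + t *: u - p| <= e + r.
  rewrite addrAC (le_trans (ler_normD _ _))// lerD ?(ltW xp)//.
  by rewrite normrZ (gtr0_norm t0).
suff : (X `&` U) y by case.
rewrite XU; split.
  apply: pU; apply/ball_rVE; rewrite distrC.
  have -> : y - p = (x + t *: u - p) - (x + t *: u - y).
    by rewrite opprB [RHS]addrC addrA subrK.
  rewrite (le_lt_trans (ler_normB _ _))//; lra.
have := desc x t (ltW t0).
have -> : `|x - p| + t * `|u| < rho by lra.
move=> /(_ isT) g1.
have dg i z : `|z - p| < rho' -> derivable g z (delta_mx ord0 i).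
  by move=> zp'; apply: (gd [::]); apply: pU; apply/ball_rVE; rewrite distrC; lra.
have g2 : `|g y - g (x + t *: u)| <= d%:R * (L * `|x + t *: u - y|).
  rewrite (distrC _ y) -{1}(subrKC (x + t *: u) y).
  by apply: (gradient_bound dg gL); rewrite (distrC y); lra.
have g3 : d%:R * (L * `|x + t *: u - y|) <= c * t.
  apply: (@le_trans _ _ (b * (e * r))).
    rewrite mulrA; apply: ler_pM => //; last exact: ltW.
    - by rewrite mulr_ge0// ltW.
    - by rewrite /b lerDl.
  rewrite mulrA /t mulrA ler_pdivlMr// mulrAC ler_pM2r// mulrC mulrA.
  rewrite -ler_pdivlMl; last by rewrite mulr_gt0.
  by rewrite [leRHS]mulrC.
have : `|g y - g (x + t *: u)| <= c * t by exact: le_trans g2 g3.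
rewrite ler_norml => /andP[_]; lra.
Qed.

Lemma admissible_corkscrew (X : set pt) : admissible_X X ->
  exists2 e : R, 0 < e & forall x, X x -> corkscrew X e x.
Proof.
move=> [X0 cX XE [sX|conv]].
  apply: compact_uniform => //; first by move=> e e' x; exact: corkscrew_mono.
  have clX : closed X by rewrite XE; exact: closed_closure.
  move=> p Xp; have [ip|nip] := pselect (interior X p).
    exact: corkscrew_interior.
  by apply: corkscrew_smooth => //; split=> //; exact: subset_closure.
apply: corkscrew_convex => //.
apply/set0P/negP => /eqP iX; have [x] := X0.
by rewrite XE iX closure0.
Qed.

End Corkscrew.

(** * Sums over lists and lower limits *)

Lemma ler_sum_mem (R : numDomainType) (T : eqType) (s : seq T) (F G : T -> R) :
  (forall x, x \in s -> F x <= G x) -> \sum_(x <- s) F x <= \sum_(x <- s) G x.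
Proof. by move=> FG; rewrite big_seq [leRHS]big_seq; exact: ler_sum. Qed.

Section LimInf.
Context {R : realType}.
Implicit Type u : (\bar R)^nat.
Local Open Scope ereal_scope.

Lemma le_limn_einf u (a : \bar R) n0 :
  (forall n, (n0 <= n)%N -> a <= u n) -> a <= limn_einf u.
Proof.
move=> au; rewrite limn_einf_lim; apply: lime_ge; first exact: is_cvg_einfs.
near=> n; apply: le_ereal_inf_tmp => _ [k /= nk <-]; apply: au.
by apply: leq_trans nk; near: n; exact: nbhs_infty_ge.
Unshelve. all: by end_near. Qed.

Lemma lt_limn_einf u (a : \bar R) :
  a < limn_einf u -> exists n0, forall n, (n0 <= n)%N -> a <= u n.
Proof.
rewrite limn_einf_lim => au; apply: contrapT => /forallNP h.
move: au; apply/negP; rewrite -leNgt; apply: lime_le; first exact: is_cvg_einfs.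
apply: nearW => n; rewrite leNgt; apply/negP => an; apply: (h n) => k nk.
by apply: le_trans (ltW an) _; apply: ereal_inf_lbound; exists k.
Qed.

End LimInf.

(** * Diameters and Hausdorff contents *)

Section Diameter.
Context {R : realType} {d : nat}.
Notation pt := 'rV[R]_d.

Lemma ediam_bounds (U : set pt) (u : pt) (c : R) : U u ->
  (ediam U <= c%:E)%E -> [/\ ediam U \is a fin_num, 0 <= fine (ediam U),
    fine (ediam U) <= c & forall v, U v -> `|u - v| <= fine (ediam U)].
Proof.
move=> Uu Uc.
have lb v : U v -> ((enorm (u - v))%:E <= ediam U)%E.
  by move=> Uv; apply: ereal_sup_ubound; exists u => //; exists v.
have U0 : (0 <= ediam U)%E.
  by apply: le_trans (lb u Uu); rewrite lee_fin enorm_ge0.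
have fU : ediam U \is a fin_num.
  by rewrite ge0_fin_numE// (le_lt_trans Uc)// ltry.
split=> //; first exact: fine_ge0.
  by rewrite -lee_fin fineK.
move=> v /lb; rewrite -{1}(fineK fU) lee_fin; apply: le_trans.
exact: norm_le_enorm.
Qed.

Lemma hcontentE (t : R) (U : set pt) : U !=set0 ->
  hcontent t U = (powR (fine (ediam U)) t)%:E.
Proof.
by rewrite /hcontent => U0; case: pselect => // UE; rewrite UE in U0; case: U0.
Qed.

Lemma hcontent0 (t : R) : hcontent t (set0 : set pt) = 0%E.
Proof. by rewrite /hcontent; case: pselect => [a|[]] /=. Qed.

Lemma hcontent_ge0 (t : R) (U : set pt) : (0 <= hcontent t U)%E.
Proof. by rewrite /hcontent; case: pselect => [a|a] //=; rewrite lee_fin powR_ge0. Qed.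

Lemma hcontent_fin (t : R) (U : set pt) : hcontent t U \is a fin_num.
Proof. by rewrite /hcontent; case: pselect => [a|a] /=. Qed.

Lemma hausdorff_measure_ge0 (t : R) (A : set pt) : (0 <= hausdorff_measure t A)%E.
Proof.
apply: (@le_trans _ _ (hausdorff_delta t 1 A)); last first.
  by apply: ereal_sup_ubound; exists 1 => //=.
apply: le_ereal_inf_tmp => _ [U _ <-]; apply: nneseries_ge0 => k _ _.
exact: hcontent_ge0.
Qed.

End Diameter.

(** * Diameter of images, uniformly over all maps *)

Section UniformDiameter.
Context {R : realType} {d : nat}.
Notation pt := 'rV[R]_d.

(** The radius is chosen before [f] and [M], which makes the later constants uniform over all
    maps. *)
Lemma diff_bound_near (V : set pt) (y : pt) : open V -> V y ->
  exists2 rho : R, 0 < rho & ball y rho `<=` V /\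
  forall (f : pt -> pt) M z, 0 <= M -> (forall x, V x -> diff_bound f M x) ->
    ball y rho z -> `|f z - f y| <= M * (d%:R * rho).
Proof.
move=> oV Vy; have : nbhs y V by exact: open_nbhs_nbhs.
rewrite -nbhs_ballE => -[rho /= rho0 yV]; exists rho => //; split=> // f M z M0 fM yz.
have fM' x : ball y rho x -> diff_bound f M x by move=> /yV /fM.
rewrite (le_trans (diff_bound_ball fM' (ballxx y rho0) yz))//.
rewrite ler_wpM2l// (le_trans (enorm_le_norm _))// ler_wpM2l// ltW//.
by rewrite distrC; apply/ball_rVE.
Qed.

(* The points of V whose image stays within a uniform multiple of M from the
   image of x0 form a clopen subset of V. *)
Lemma uniform_diameter (X V : set pt) :
  X !=set0 -> compact X -> X `<=` V -> open V -> connected V ->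
  exists2 C : R, 0 < C & forall (f : pt -> pt) M, 0 <= M ->
    (forall x, V x -> diff_bound f M x) ->
    forall x y, X x -> X y -> `|f y - f x| <= C * M.
Proof.
move=> [x0 Xx0] cX XV oV coV.
pose good y (C : R) := forall (f : pt -> pt) M, 0 <= M ->
  (forall x, V x -> diff_bound f M x) -> `|f y - f x0| <= C * M.
pose B := [set y | V y /\ exists C, good y C].
have loc y : V y -> exists2 rho : R, 0 < rho & ball y rho `<=` V /\
    forall z, ball y rho z ->
      (forall C, good y C -> good z (C + d%:R * rho)) /\
      (forall C, good z C -> good y (C + d%:R * rho)).
  move=> /(diff_bound_near oV)[rho rho0 [yV yrho]]; exists rho => //; split=> // z yz.
  split=> C gC f M M0 fM; have h1 := yrho f M z M0 fM yz; have h2 := gC f M M0 fM.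
    rewrite (le_trans (ler_distD (f y) _ _))// mulrDl addrC lerD//.
    by rewrite [leRHS]mulrC.
  rewrite (le_trans (ler_distD (f z) _ _))// mulrDl addrC lerD//.
  by rewrite distrC [leRHS]mulrC.
have oB : open B.
  rewrite openE => y [/loc[rho rho0 [yV yrho]] [C yC]].
  rewrite /interior/= -nbhs_ballE; exists rho => //= z yz; split; first exact: yV.
  by have [/(_ C yC) h _] := yrho z yz; exists (C + d%:R * rho).
have oVB : open (V `\` B).
  rewrite openE => y [/[dup] Vy /loc[rho rho0 [yV yrho]] nBy].
  rewrite /interior/= -nbhs_ballE; exists rho => //= z yz; split; first exact: yV.
  move=> [_ [C zC]]; apply: nBy; split=> //.
  by have [_ /(_ C zC) h] := yrho z yz; exists (C + d%:R * rho).
have BV : B = V.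
  apply: coV.
  - exists x0; split; first exact: XV.
    by exists 0 => f M M0 _; rewrite subrr normr0 mul0r.
  - by exists B => //; rewrite setIC; apply/esym/setIidPl => y [].
  - exists (~` (V `\` B)); first exact: open_closedC.
    apply/seteqP; split=> [y By|y [Vy nVB]].
      by split; [case: By|case].
    by apply: contrapT => nBy; apply: nVB.
(* The constant is written as [e^-1] so that the property improves as [e] decreases, as the
   compactness argument requires. *)
have [e e0 eX] : exists2 e : R, 0 < e & forall x, X x -> good x e^-1.
  apply: (compact_uniform (P := fun e x => good x e^-1)) => //.
    move=> e e' x /andP[e'0 e'e] gx f M M0 fM.
    rewrite (le_trans (gx f M M0 fM))// ler_wpM2r// lef_pV2 ?posrE//.
    exact: lt_le_trans e'e.
  move=> p /XV Vp; have [rho rho0 [_ prho]] := loc p Vp.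
  have [_ [C pC]] : B p by rewrite BV.
  pose C1 := `|C| + d%:R * rho + 1.
  have C10 : 0 < C1 by rewrite ltr_wpDl// addr_ge0// mulr_ge0// ltW.
  pose e := Num.min rho C1^-1.
  exists e; first by rewrite lt_min rho0 invr_gt0.
  move=> x Xx; rewrite lt_min => /andP[xp _] f M M0 fM.
  have px : ball p rho x by apply/ball_rVE; rewrite distrC.
  have [/(_ C pC) gx _] := prho x px.
  rewrite (le_trans (gx f M M0 fM))// ler_wpM2r//.
  apply: (@le_trans _ _ C1).
    by rewrite /C1 -addrA lerD ?ler_norm// lerDl.
  rewrite -[leLHS]invrK lef_pV2 ?posrE ?lt_min ?rho0 ?invr_gt0//.
  by rewrite ge_min lexx orbT.
exists (2 / e); first by rewrite divr_gt0.
move=> f M M0 fM x y Xx Xy.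
have := eX x Xx f M M0 fM; have := eX y Xy f M M0 fM => hy hx.
rewrite (le_trans (ler_distD (f x0) _ _))// (distrC (f x0)).
have -> : 2 / e * M = e^-1 * M + e^-1 * M by ring.
exact: lerD.
Qed.

End UniformDiameter.

(** * Derivative norms and images of words *)

Section System.
Context {R : realType} {d : nat}.
Notation pt := 'rV[R]_d.
Context (X V : set pt) (phi : nat -> nat -> pt -> pt) (m : nat -> nat).
Context (K eta : R).
Hypotheses (d0 : (0 < d)%N) (X0 : X !=set0) (XV : X `<=` V) (K1 : 1 <= K).
Hypothesis m0 : forall j, (0 < m j)%N.
Hypothesis phiX : forall j i, (i < m j)%N -> phi j i @` X `<=` X.
Hypothesis osc : forall j a b, (a < m j)%N -> (b < m j)%N -> a != b ->
  phi j a @` interior X `&` phi j b @` interior X = set0.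
Hypothesis cphi : forall j i, (i < m j)%N -> conformal_map V (phi j i).
Hypothesis dist : forall k w, valid_word m k w -> distortion V K (comp_from phi k w).
Hypothesis phi_eta : forall j i, (i < m j)%N -> Dnorm X (phi j i) <= eta.

#[local] Opaque Dnorm dnorm.

Notation D k w := (Dnorm X (comp_from phi k w)).

Let K0 : 0 < K. Proof. exact: lt_le_trans K1. Qed.
Let dR : 0 < d%:R :> R. Proof. by rewrite ltr0n. Qed.

Lemma comp_from_cat k u v :
  comp_from phi k (u ++ v) = comp_from phi k u \o comp_from phi (k + size u) v.
Proof.
elim: u k => [|i u IH] k /=; first by rewrite addn0.
by rewrite IH addSnnS.
Qed.

Lemma valid_word_cons k i w :
  valid_word m k (i :: w) <-> (i < m k)%N /\ valid_word m k.+1 w.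
Proof.
rewrite -cat1s valid_word_cat addn1; split=> -[h1 h2]; split=> //.
  by have := h1 0%N isT; rewrite addn0.
by case=> //= _; rewrite addn0.
Qed.

Lemma comp_from_conformal k w :
  valid_word m k w -> conformal_map V (comp_from phi k w).
Proof.
elim: w k => [|i w IH] k; first by move=> _; exact: conformal_id.
move=> /valid_word_cons[im /IH cw]; exact: conformal_comp (cphi im) cw.
Qed.

Lemma comp_from_X k w : valid_word m k w -> comp_from phi k w @` X `<=` X.
Proof.
elim: w k => [|i w IH] k; first by move=> _; rewrite /= image_id.
move=> /valid_word_cons[im /IH wX] _ [x Xx <-] /=.
by apply: phiX im _ _; exists (comp_from phi k.+1 w x) => //; apply: wX; exists x.
Qed.

Lemma Dword_gt0 k w : valid_word m k w -> 0 < D k w.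
Proof.
by move=> vw; apply: (Dnorm_gt0 d0 X0 XV (comp_from_conformal vw) (dist vw)).
Qed.

Lemma Dword_nil k : D k [::] = 1.
Proof.
apply/eqP; rewrite eq_le; apply/andP; split.
  by apply: (Dnorm_le X0) => x _; rewrite dnorm_id.
have [x Xx] := X0; rewrite -(dnorm_id (R := R) d0 x).
by apply: (dnorm_le_Dnorm XV (dist (k := k) (w := [::]) _)).
Qed.

Lemma Dword_cat_le k u v : valid_word m k (u ++ v) ->
  D k (u ++ v) <= D k u * D (k + size u) v.
Proof.
move=> /valid_word_cat[vu vv]; rewrite comp_from_cat.
apply: (Dnorm_comp_le d0 X0 XV _ _ (dist vu) (dist vv));
  [exact: comp_from_conformal|exact: comp_from_conformal|exact: comp_from_X].
Qed.

Lemma Dword_cat_ge k u v : valid_word m k (u ++ v) ->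
  D k u * D (k + size u) v <= K * D k (u ++ v).
Proof.
move=> vuv; have /valid_word_cat[vu vv] := vuv.
have := dist vuv; rewrite comp_from_cat => duv.
apply: (Dnorm_comp_ge d0 X0 XV K1 _ _ (dist vu) duv);
  [exact: comp_from_conformal|exact: comp_from_conformal|exact: comp_from_X].
Qed.

Lemma eta_gt0 : 0 < eta.
Proof.
apply: lt_le_trans (phi_eta (m0 0)).
by have := @Dword_gt0 0 [:: 0%N]; apply; case=> //= _; exact: m0.
Qed.

Lemma Dword_le_eta k w : valid_word m k w -> D k w <= eta ^+ size w.
Proof.
elim: w k => [|i w IH] k vw; first by rewrite Dword_nil.
have /valid_word_cons[im vw'] := vw.
rewrite -cat1s in vw *; rewrite (le_trans (Dword_cat_le vw))// addn1 exprS.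
have /valid_word_cat[vi _] := vw.
have h0 := ltW (Dword_gt0 vi); have h1 := ltW (Dword_gt0 vw').
exact: (ler_pM h0 h1 (phi_eta im) (IH _ vw')).
Qed.

(** By distortion the single number [D k w] controls the differential from both sides on all of
    [V]. *)
Lemma dword_bounds k w x : valid_word m k w -> V x ->
  diff_bound (comp_from phi k w) (K * D k w) x /\
  forall v, D k w / K * enorm v <= enorm ('d (comp_from phi k w) x v).
Proof.
move=> vw Vx; have cw := comp_from_conformal vw.
have [_ dw] := conformal_dnorm d0 cw Vx.
split.
  split; first by have [_ _ + _] := cw; apply.
  move=> v; rewrite dw ler_wpM2r ?enorm_ge0//.
  by apply: (dnorm_le_KDnorm X0 XV K1 (dist vw)).
move=> v; rewrite dw ler_wpM2r ?enorm_ge0// ler_pdivrMr// mulrC.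
by apply: (Dnorm_le_Kdnorm X0 XV (dist vw)).
Qed.

Lemma comp_from_ball k w x r : valid_word m k w -> 0 < r ->
  (forall y, `|y - x| <= r -> V y) ->
  ball (comp_from phi k w x) (D k w / K / (2 * d%:R) * r) `<=`
    comp_from phi k w @` ball x r.
Proof.
move=> vw r0 xV; apply: ball_subset_image => //.
  by rewrite divr_gt0// Dword_gt0.
move=> y /xV /(dword_bounds vw)[[dy _] ylow]; split=> // v; exact: ylow.
Qed.

Lemma comp_from_interior k w :
  valid_word m k w -> comp_from phi k w @` interior X `<=` interior X.
Proof.
move=> vw _ [x ix <-]; move: ix; rewrite /interior/= -!nbhs_ballE => -[r /= r0 xX].
have r2 : 0 < r / 2 by rewrite divr_gt0.
exists (D k w / K / (2 * d%:R) * (r / 2)) => /=.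
  apply: mulr_gt0 => //; apply: divr_gt0; last by rewrite mulr_gt0.
  by rewrite divr_gt0// Dword_gt0.
apply: subset_trans (comp_from_ball vw r2 _) _.
  move=> y yx; apply: XV; apply: xX; apply/ball_rVE; rewrite distrC.
  by apply: le_lt_trans yx _; rewrite ltr_pdivrMr// ltr_pMr// ltr1n.
move=> _ [y xy <-]; apply: (comp_from_X vw); exists y => //; apply: xX.
by apply: le_ball xy; rewrite ler_pdivrMr// ler_pMr// ler1n.
Qed.

(** Common first letters are stripped by injectivity. At the first disagreement, which exists since
    neither word is a prefix of the other, the open set condition applies. *)
Lemma comp_from_disjoint k u v : valid_word m k u -> valid_word m k v ->
  ~~ prefix u v -> ~~ prefix v u ->
  comp_from phi k u @` interior X `&` comp_from phi k v @` interior X = set0.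
Proof.
elim: u k v => [|a u IH] k [|b v]//.
move=> /valid_word_cons[am vu] /valid_word_cons[bm vv] /=.
have iXV x : interior X x -> V x by move=> /interior_subset /XV.
rewrite [b == a]eq_sym; have [->{a am}|ab] := eqVneq a b => /= p1 p2; last first.
  rewrite -subset0 => _ [[x ix <-] [y iy /= E]].
  suff : (phi k a @` interior X `&` phi k b @` interior X)
      (phi k a (comp_from phi k.+1 u x)) by rewrite (osc am bm ab).
  split; first by exists (comp_from phi k.+1 u x) => //;
    apply: comp_from_interior vu _ _; exists x.
  by rewrite -E; exists (comp_from phi k.+1 v y) => //;
    apply: comp_from_interior vv _ _; exists y.
rewrite -subset0 => _ [[x ix <-] [y iy /= E]].
suff : (comp_from phi k.+1 u @` interior X `&` comp_from phi k.+1 v @` interior X)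
    (comp_from phi k.+1 u x) by rewrite (IH _ _ vu vv p1 p2).
split; first by exists x.
exists y => //.
have [inj _ _ _] := cphi bm; apply: inj => //; rewrite inE; apply: iXV.
- by apply: comp_from_interior vv _ _; exists y.
- by apply: comp_from_interior vu _ _; exists x.
Qed.

(** * Bounded overlap of images meeting a ball *)

Hypotheses (cX : compact X) (oV : open V) (coV : connected V).
Hypothesis cork : exists2 e : R, 0 < e & forall x, X x -> corkscrew X e x.

Lemma word_diameter : exists2 C : R, 0 < C & forall k w, valid_word m k w ->
  forall x y, X x -> X y ->
    `|comp_from phi k w y - comp_from phi k w x| <= C * D k w.
Proof.
have [C C0 HC] := uniform_diameter X0 cX XV oV coV.
exists (C * K) => [|k w vw x y Xx Xy]; first by rewrite mulr_gt0.
rewrite -mulrA; apply: HC => //; first by rewrite mulr_ge0 ?ltW// Dword_gt0.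
by move=> z Vz; have [] := dword_bounds vw Vz.
Qed.

Lemma ball_sub_V : exists2 e : R, 0 < e & forall x, X x -> ball x e `<=` V.
Proof.
apply: (compact_uniform (P := fun e x => ball x e `<=` V)) => //.
  by move=> e e' x /andP[_ e'e]; apply: subset_trans; exact: le_ball.
move=> p /XV Vp; have : nbhs p V by exact: open_nbhs_nbhs.
rewrite -nbhs_ballE => -[e /= e0 pV]; exists (e / 2); first by rewrite divr_gt0.
move=> x _ xp y /ball_rVE xy; apply: pV; apply/ball_rVE.
rewrite (le_lt_trans (ler_distD x _ _))// (distrC p); lra.
Qed.

(** The radius [r] is pulled back to the scale [r / D 0 w] in [X], the corkscrew ball near [x] is
    taken there, and the open mapping estimate pushes it forward. *)
Lemma anchor_ball : exists c A : R, [/\ 0 < c, 0 < A &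
  forall w r x, valid_word m 0 w -> 0 < r <= D 0 w -> X x ->
    exists p, [/\ `|p - comp_from phi 0 w x| <= A * r,
      (comp_from phi 0 w @` interior X) p &
      ball p (c * r) `<=` comp_from phi 0 w @` interior X]].
Proof.
have [e e0 eX] := cork; have [rho rho0 rV] := ball_sub_V.
pose e1 := Num.min e (rho / 2).
have e10 : 0 < e1 by rewrite lt_min e0 divr_gt0.
have e1e : e1 <= e by rewrite ge_min lexx.
have e1r : e1 <= rho / 2 by rewrite ge_min lexx orbT.
(* The first 2 shrinks the corkscrew ball so that its closed version stays inside; [K] and [2 * d]
   are lost in the open mapping estimate. *)
pose c := e1 * e / 2 / K / (2 * d%:R).
have c0 : 0 < c by rewrite !divr_gt0// mulr_gt0.
pose A := K * d%:R * e1; have A0 : 0 < A by rewrite !mulr_gt0.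
exists c, A; split=> // w r x vw /andP[r0 rD] Xx.
have Dw0 := Dword_gt0 vw.
pose r1 := e1 * (r / D 0 w).
have rD0 : 0 < r / D 0 w by rewrite divr_gt0.
have rD1 : r / D 0 w <= 1 by rewrite ler_pdivrMr// mul1r.
have r10 : 0 < r1 by rewrite mulr_gt0.
have r1e1 : r1 <= e1 by rewrite ler_piMr// ltW.
have [|z zx zX] := eX _ Xx r1; first by rewrite r10 (le_trans r1e1).
have er1 : 0 < e * r1 by rewrite mulr_gt0.
have er2 : 0 < e * r1 / 2 by rewrite divr_gt0.
have half y : `|y - z| <= e * r1 / 2 -> ball z (e * r1) y.
  move=> yz; apply/ball_rVE; rewrite distrC; apply: le_lt_trans yz _.
  by rewrite ltr_pdivrMr// ltr_pMr// ltr1n.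
have iX y : ball z (e * r1) y -> interior X y.
  move=> yz; apply: (interiorS zX); apply: open_nbhs_nbhs; split=> //.
  exact: ball_open.
exists (comp_from phi 0 w z); split.
- have fb y : ball x rho y -> diff_bound (comp_from phi 0 w) (K * D 0 w) y.
    by move=> /(rV _ Xx) Vy; have [] := dword_bounds vw Vy.
  have zr : ball x rho z.
    apply/ball_rVE; rewrite distrC (le_lt_trans zx)// (le_lt_trans r1e1)//.
    by rewrite (le_lt_trans e1r)// ltr_pdivrMr// ltr_pMr// ltr1n.
  apply: le_trans (diff_bound_ball fb (ballxx x rho0) zr) _.
  apply: (@le_trans _ _ (K * D 0 w * (d%:R * r1))).
    apply: ler_wpM2l; first by rewrite ltW// mulr_gt0.
    rewrite (le_trans (enorm_le_norm _))//.
    by rewrite ler_wpM2l.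
  suff -> : K * D 0 w * (d%:R * r1) = A * r by [].
  by rewrite /A /r1; field; rewrite gt_eqF.
- by exists z => //; apply: iX; exact: ballxx.
- have hV y : `|y - z| <= e * r1 / 2 -> V y by move=> /half /zX /XV.
  apply: subset_trans (subset_trans (comp_from_ball vw er2 hV) _).
    apply: le_ball; rewrite le_eqVlt; apply/orP; left; apply/eqP.
    by rewrite /c /r1; field; rewrite !gt_eqF.
  move=> _ [y yz <-]; exists y => //; apply/iX/half.
  by rewrite distrC; apply/ltW/ball_rVE.
Qed.

(** Images of the interior under words of an antichain are disjoint, so their anchor points are
    [c * r] apart while lying within [(1 + A) * r] of [o]; the packing bound with ratio
    [c / (1 + A)] applies. *)
Lemma meeting_bound : exists N : nat, forall (s : seq (seq nat)) (o : pt) (r : R),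
  0 < r -> uniq s ->
  (forall w, w \in s -> [/\ valid_word m 0 w, r <= D 0 w &
    exists2 x, X x & `|comp_from phi 0 w x - o| <= r]) ->
  (forall u v, u \in s -> v \in s -> u != v -> ~~ prefix u v) ->
  (size s <= N)%N.
Proof.
have [c [A [c0 A0 anch]]] := anchor_ball.
have [N HN] := packing_bound (d := d) (divr_gt0 c0 (ltr_wpDr (ltW A0) ltr01)).
exists N => s o r r0 us hs anti.
have /choice[p hp] (w : seq nat) : exists p : pt, w \in s ->
    [/\ `|p - o| <= (1 + A) * r,
      (comp_from phi 0 w @` interior X) p &
      ball p (c * r) `<=` comp_from phi 0 w @` interior X].
  have [ws|_] := boolP (w \in s); last by exists o.
  have [vw rD [x Xx xo]] := hs w ws.
  have [|p [p1 p2 p3]] := anch w r x vw _ Xx; first by rewrite r0.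
  exists p => _; split=> //.
  rewrite (le_trans (ler_distD (comp_from phi 0 w x) _ _))//.
  by rewrite mulrDl mul1r addrC lerD.
have A1 : 0 < 1 + A by rewrite addr_gt0.
apply: (HN _ s p o ((1 + A) * r)) => //.
- by rewrite mulr_gt0.
- by move=> w /hp[].
move=> u v us' vs uv; rewrite mulrA divfK ?gt_eqF// leNgt; apply/negP => pq.
have [_ _ bu] := hp u us'; have [_ pv _] := hp v vs.
have [vu _ _] := hs u us'; have [vv _ _] := hs v vs.
suff : (comp_from phi 0 u @` interior X `&` comp_from phi 0 v @` interior X) (p v).
  rewrite comp_from_disjoint//; first exact: anti.
  by apply: anti => //; rewrite eq_sym.
by split=> //; apply: bu; exact/ball_rVE.
Qed.

(** * Partition sums, cylinders and siblings *)

Context (kappa : R) (q : nat).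
Hypothesis eta1 : eta < 1.
Hypotheses (kappa1 : 1 <= kappa) (mq : forall n, (m n <= q)%N).
Hypothesis bal : forall n a b, (a < m n)%N -> (b < m n)%N ->
  Dnorm X (phi n a) / Dnorm X (phi n b) <= kappa.

Definition Zfrom k n (t : R) : R :=
  \sum_(w <- words (fun j => m (k + j)%N) n) powR (D k w) t.

Lemma Zn_Zfrom n t : Zn X phi m n t = Zfrom 0 n t.
Proof. by []. Qed.

Lemma mem_words0 n w : w \in words m n <-> size w = n /\ valid_word m 0 w.
Proof. exact: (mem_words m 0). Qed.

Lemma Zfrom_gt0 k n t : 0 < Zfrom k n t.
Proof.
have [w wn] : exists w, w \in words (fun j => m (k + j)%N) n.
  exists (nseq n 0%N); apply/mem_words; rewrite size_nseq; split=> // j jn.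
  by rewrite nth_nseq; case: ifP => _; exact: m0.
have pos v : 0 <= powR (D k v) t by exact: powR_ge0.
rewrite /Zfrom (bigD1_seq w wn (words_uniq _ _))/= ltr_wpDr ?sumr_ge0//.
by rewrite powR_gt0// Dword_gt0//; have /mem_words[] := wn.
Qed.

Lemma Zfrom0 n t : Zfrom 0 n t = \sum_(w <- words m n) powR (D 0 w) t.
Proof. by []. Qed.

Lemma Zfrom_cat_ge j l t : 0 <= t ->
  Zfrom 0 j t * Zfrom j l t <= powR K t * Zfrom 0 (j + l) t.
Proof.
move=> t0; rewrite !Zfrom0 /Zfrom sum_words_cat mulr_suml mulr_sumr.
apply: ler_sum_mem => u /mem_words0[su vu].
rewrite !mulr_sumr; apply: ler_sum_mem => v /(mem_words m j)[sv vv].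
have vuv : valid_word m 0 (u ++ v) by apply/valid_word_cat; rewrite su.
have vv' : valid_word m j v by [].
have Du := ltW (Dword_gt0 vu); have Dv := ltW (Dword_gt0 vv').
have Duv := ltW (Dword_gt0 vuv); have h := Dword_cat_ge vuv.
rewrite su add0n in h; have := ltW K0.
move: (D 0 u) (D j v) (D 0 (u ++ v)) Du Dv Duv h => a b c a0 b0 c0 h K0'.
rewrite -!powRM//; apply: ge0_ler_powR => //; rewrite nnegrE mulr_ge0//.
Qed.

(** An extension of [u] is a child of [u], one of at most [q], followed by a tail, and its norm is
    at most [c] times that of the tail. The factor [Zfrom 0 (size u).+1 t] turns the tail sum into
    the full sum and will later be bounded below by [M]. *)
Lemma cylinder_sum u l (c t : R) : 0 <= t -> valid_word m 0 u ->
  (forall i, (i < m (size u))%N -> D 0 (rcons u i) <= c) ->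
  Zfrom 0 (size u).+1 t *
    \sum_(w <- words m ((size u).+1 + l) | prefix u w) powR (D 0 w) t
  <= q%:R * powR c t * powR K t * Zfrom 0 ((size u).+1 + l) t.
Proof.
move=> t0 vu uc; set j := size u.
have c0 : 0 <= c.
  by apply: le_trans (uc 0%N (m0 _)); apply/ltW/Dword_gt0/valid_word_rcons.
suff H : \sum_(w <- words m (j.+1 + l) | prefix u w) powR (D 0 w) t <=
    q%:R * powR c t * Zfrom j.+1 l t.
  have Zj := Zfrom_gt0 0 j.+1 t.
  apply: le_trans (ler_wpM2l (ltW Zj) H) _.
  rewrite mulrCA -[leRHS]mulrA ler_wpM2l ?Zfrom_cat_ge//.
  by rewrite mulr_ge0// powR_ge0.
rewrite big_mkcond sum_words_cat [X in \sum_(u <- X) _]/= big_allpairs_dep.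
have uw : u \in words m j by apply/mem_words0.
(* Among the initial segments of length [size u] only [u] itself contributes. *)
rewrite (bigD1_seq u uw (words_uniq _ _))/= [X in _ + X]big_seq_cond.
rewrite [X in _ + X]big1 ?addr0; last first.
  move=> v /andP[/mem_words0[sv _] vu'].
  apply: big1 => i _; apply: big1 => w _.
  rewrite -cats1 -catA prefixE take_cat /= -/j sv ltnn subnn take0 cats0.
  by rewrite (negbTE vu').
apply: (@le_trans _ _ (\sum_(i <- iota 0 (m j)) powR c t * Zfrom j.+1 l t)).
  apply: ler_sum_mem => i; rewrite mem_iota => /= im.
  rewrite mulr_sumr; apply: ler_sum_mem => v /(mem_words m j.+1)[sv vv].
  have vui : valid_word m 0 (rcons u i) by apply/valid_word_rcons.
  have vuv : valid_word m 0 (rcons u i ++ v).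
    by apply/valid_word_cat; rewrite size_rcons.
  have vv' : valid_word m j.+1 v by [].
  have Dv := ltW (Dword_gt0 vv'); have Duv := ltW (Dword_gt0 vuv).
  have h := Dword_cat_le vuv; rewrite size_rcons add0n in h.
  have := uc i im; rewrite cat_rcons prefix_prefix -cat_rcons.
  move: (D 0 (rcons u i)) (D j.+1 v) (D 0 (rcons u i ++ v)) Dv Duv h.
  move=> a b e b0 e0 h ac; rewrite -powRM//.
  apply: ge0_ler_powR; rewrite ?nnegrE ?mulr_ge0//.
  by rewrite (le_trans h)// ler_wpM2r.
rewrite big_const_seq count_predT iter_addr_0 size_iota.
rewrite -[leLHS]mulr_natl -mulrA ler_wpM2r ?ler_nat//.
by rewrite mulr_ge0 ?powR_ge0// ltW// Zfrom_gt0.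
Qed.

(** Balancedness compares the last maps of the two siblings at the cost of [kappa]; almost
    multiplicativity costs [K]. *)
Lemma children_le u i a (r : R) : valid_word m 0 u -> (i < m (size u))%N ->
  (a < m (size u))%N -> D 0 (rcons u i) <= r -> D 0 (rcons u a) <= K * kappa * r.
Proof.
move=> vu im am ur.
have vui : valid_word m 0 (u ++ [:: i]) by rewrite cats1; apply/valid_word_rcons.
have vua : valid_word m 0 (u ++ [:: a]) by rewrite cats1; apply/valid_word_rcons.
have /valid_word_cat[_ vi] := vui; have /valid_word_cat[_ va] := vua.
have h1 := Dword_cat_le vua; have h2 := Dword_cat_ge vui.
have h3 : D (0 + size u) [:: a] <= kappa * D (0 + size u) [:: i].
  rewrite -ler_pdivrMr; last exact: Dword_gt0.
  exact: bal.
rewrite cats1 in h1; rewrite cats1 in h2.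
apply: le_trans h1 _; have Du := Dword_gt0 vu.
apply: le_trans (ler_wpM2l (ltW Du) h3) _.
rewrite mulrCA [K * _]mulrC -mulrA ler_wpM2l ?(le_trans ler01)//.
by apply: le_trans h2 _; rewrite ler_wpM2l// ltW.
Qed.

(** There are finitely many words of length at most [n]. The bound forces words of small norm to be
    long. *)
Lemma Dword_lower_bound n : exists2 delta : R, 0 < delta &
  forall w, valid_word m 0 w -> (size w <= n)%N -> delta < D 0 w.
Proof.
have aux (s : seq (seq nat)) : (forall w, w \in s -> valid_word m 0 w) ->
    exists2 delta : R, 0 < delta & forall w, w \in s -> delta < D 0 w.
  elim: s => [_|v s IH vs]; first by exists 1.
  have [|delta d1 hd] := IH; first by move=> w ws; apply: vs; rewrite inE ws orbT.
  have Dv : 0 < D 0 v by apply: Dword_gt0; apply: vs; rewrite mem_head.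
  exists (Num.min delta (D 0 v / 2)); first by rewrite lt_min d1 divr_gt0.
  move=> w; rewrite inE gt_min => /predU1P[->|/hd->//].
  by rewrite ltr_pdivrMr// ltr_pMr// ltr1n orbT.
have [|delta d1 hd] := aux (flatten [seq words m k | k <- iota 0 n.+1]).
  by move=> w /flatten_mapP[k _ /mem_words0[]].
exists delta => // w vw sw; apply: hd; apply/flatten_mapP; exists (size w).
  by rewrite mem_iota add0n ltnS.
exact/mem_words0.
Qed.

(** * Stopping words and the mass of a ball *)

Let crit (r : R) (u : seq nat) : bool :=
  has (fun i => D 0 (rcons u i) <= r) (iota 0 (m (size u))).

(* The length of the shortest prefix of w that has a child of norm at most r. *)
Let cut (r : R) (w : seq nat) : nat :=
  find (fun j => crit r (take j w)) (iota 0 (size w)).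

Let take_rcons (w : seq nat) j : (j < size w)%N ->
  take j.+1 w = rcons (take j w) (nth 0%N w j).
Proof. by move=> jw; rewrite (take_nth 0%N). Qed.

Let valid_take j w : valid_word m 0 w -> valid_word m 0 (take j w).
Proof. by rewrite -{1}(cat_take_drop j w) => /valid_word_cat[]. Qed.

(** As long as no earlier prefix is critical, norms of prefixes stay above [r], starting from [D 0
    [::] = 1]. Since [D 0 w <= r], some proper prefix must be critical. *)
Let cutP r w : r < 1 -> valid_word m 0 w -> D 0 w <= r ->
  [/\ (cut r w < size w)%N, crit r (take (cut r w) w) & r < D 0 (take (cut r w) w)].
Proof.
move=> r1 vw wr.
have child j : (j < size w)%N -> D 0 (take j.+1 w) <= r -> crit r (take j w).
  move=> jw; rewrite take_rcons// => h; apply/hasP; exists (nth 0%N w j) => //.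
  rewrite mem_iota/= add0n size_takel ?(ltnW jw)//.
  by have := vw j jw; rewrite add0n.
have hasc : has (fun j => crit r (take j w)) (iota 0 (size w)).
  apply: contraT => /hasPn nc.
  have big j : (j <= size w)%N -> r < D 0 (take j w).
    elim: j => [|j IH] jw; first by rewrite take0 Dword_nil.
    rewrite ltNge; apply/negP => /(child _ jw); apply/negP.
    by apply: nc; rewrite mem_iota.
  by have := big _ (leqnn _); rewrite take_size ltNge wr.
have cw : (cut r w < size w)%N by move: hasc; rewrite has_find size_iota.
split=> //.
  by have := nth_find 0%N hasc; rewrite nth_iota// add0n.
case E : (cut r w) => [|j]; first by rewrite take0 Dword_nil.
have jw : (j < size w)%N by rewrite ltnW// -E.
have : crit r (take j w) = false.
  have := @before_find _ 0%N (fun j => crit r (take j w)) (iota 0 (size w)) j.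
  by rewrite nth_iota// add0n; apply; rewrite -/(cut r w) E.
by move/negbT; rewrite ltNge; apply: contra; exact: child.
Qed.

Let cut_min r w j : (j < size w)%N -> crit r (take j w) -> (cut r w <= j)%N.
Proof.
move=> jw cj; rewrite leqNgt; apply/negP => jc.
by have := before_find 0%N jc; rewrite nth_iota// add0n cj.
Qed.

Definition meets (o : pt) (r : R) (w : seq nat) : bool :=
  `[< exists2 x, X x & `|comp_from phi 0 w x - o| <= r >].

(** Words meeting the ball are grouped by their stopping prefixes: at most [N] cylinders, each of
    mass at most a constant times [r] to the power [t] over [M]. The constant [B] precedes [M], so
    the final lower bound is linear in [M]. *)
Lemma ball_mass (t : R) : 0 <= t -> exists2 B : R, 0 < B &
  forall (M : R) (k0 : nat), 0 < M -> (forall k, (k0 <= k)%N -> M <= Zfrom 0 k t) ->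
  exists2 delta : R, 0 < delta & forall (o : pt) (r : R), 0 < r < delta ->
  exists n1 : nat, forall n, (n1 <= n)%N ->
    \sum_(w <- words m n | meets o r w) powR (D 0 w) t
    <= B / M * powR r t * Zfrom 0 n t.
Proof.
move=> t0; have [N HN] := meeting_bound.
pose B0 := q%:R * powR (K * kappa) t * powR K t.
have kap0 : 0 < kappa by exact: lt_le_trans kappa1.
have B00 : 0 <= B0 by rewrite !mulr_ge0// powR_ge0.
exists (N%:R * B0 + 1); first by rewrite ltr_wpDl// mulr_ge0.
move=> M k0 M0 ZM; have [delta del0 Hdel] := Dword_lower_bound k0.
exists (Num.min delta 1); first by rewrite lt_min del0 ltr01.
move=> o r /andP[r0]; rewrite lt_min => /andP[rdel r1].
(* Beyond [n1] every word of length [n] has norm at most [r], hence a stopping prefix. *)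
have [n1 Hn1] : exists n1, forall n, (n1 <= n)%N -> forall w, w \in words m n -> D 0 w <= r.
  have /cvgrPdist_le/(_ _ r0)[n1 _ Hn1] : eta ^+ n @[n --> \oo] --> (0 : R).
    by apply: cvg_expr; rewrite gtr0_norm ?eta_gt0.
  exists n1 => n /Hn1 + w /mem_words0[sw vw].
  rewrite sub0r normrN gtr0_norm ?exprn_gt0 ?eta_gt0// => /(le_trans _); apply.
  by rewrite -sw Dword_le_eta.
exists n1 => n n1n.
have Hw w : w \in words m n -> [/\ size w = n, valid_word m 0 w & D 0 w <= r].
  by move=> wn; have /mem_words0[] := wn; split=> //; exact: Hn1 wn.
pose P := undup [seq take (cut r w) w | w <- words m n & meets o r w].
have inP u : u \in P -> exists2 w, [/\ size w = n, valid_word m 0 w & D 0 w <= r] &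
    meets o r w /\ u = take (cut r w) w.
  rewrite mem_undup => /mapP[w]; rewrite mem_filter => /andP[mw /Hw hw] ->.
  by exists w.
have sP : (size P <= N)%N.
  apply: (HN P o r r0 (undup_uniq _)).
    move=> u /inP[w [sw vw wr] [mw ->]].
    have [_ _ /ltW rD] := cutP r1 vw wr.
    split=> //; first exact: valid_take.
    have /asboolP[x Xx xo] := mw.
    have := vw; rewrite -{1}(cat_take_drop (cut r w) w) => /valid_word_cat[vt vd].
    exists (comp_from phi (0 + size (take (cut r w) w)) (drop (cut r w) w) x).
      by apply: (comp_from_X vd); exists x.
    by move: xo; rewrite -{1}(cat_take_drop (cut r w) w) comp_from_cat.
  (* Antichain: if [u] were a prefix of [v], it would be a critical prefix of [w'], and minimality
     of the cut would give [u = v]. *)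
  move=> u v /inP[w [sw vw wr] [_ uE]] /inP[w' [sw' vw' wr'] [_ vE]] uv.
  apply/negP => puv; move/negP: uv; apply.
  have [cw crw _] := cutP r1 vw wr; have [cw' _ _] := cutP r1 vw' wr'.
  have su : size u = cut r w by rewrite uE size_takel// ltnW.
  have sv : size v = cut r w' by rewrite vE size_takel// ltnW.
  have suv : (size u <= size v)%N by have /prefixP[s' ->] := puv; rewrite size_cat leq_addr.
  have uE' : u = take (cut r w) w'.
    move: puv; rewrite prefixE => /eqP <-; rewrite su vE take_takel//.
    by rewrite -su -sv.
  have : (cut r w' <= cut r w)%N.
    apply: cut_min; first by rewrite sw' -sw.
    by rewrite -uE' uE.
  rewrite -su -sv => svu; rewrite uE' vE; apply/eqP; congr (take _ _).
  by rewrite -su -sv; apply/eqP; rewrite eqn_leq suv svu.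
have Zn0 := Zfrom_gt0 0 n t.
have cyl u : u \in P -> \sum_(w <- words m n | prefix u w) powR (D 0 w) t
    <= B0 * powR r t / M * Zfrom 0 n t.
  move=> /inP[w [sw vw wr] [_ uE]].
  have [cw crw _] := cutP r1 vw wr; rewrite -uE in crw.
  have vu : valid_word m 0 u by rewrite uE; exact: valid_take.
  have su : (size u < n)%N by rewrite uE size_takel -?sw// ltnW.
  have /hasP[i] := crw; rewrite mem_iota/= add0n => im ir.
  have nE : n = ((size u).+1 + (n - (size u).+1))%N by rewrite subnKC.
  have kr0 : 0 <= K * kappa * r by rewrite !mulr_ge0// ltW.
  have := cylinder_sum (n - (size u).+1) t0 vu
    (fun a am => children_le vu im am ir); rewrite -nE.
  (* The child [rcons u i] has norm at most [r < delta], so its length is at least [k0]. *)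
  have ZM' : M <= Zfrom 0 (size u).+1 t.
    apply: ZM; rewrite leqNgt; apply/negP => sk.
    have := Hdel (rcons u i); rewrite size_rcons => /(_ _ (ltnW sk)).
    have vui : valid_word m 0 (rcons u i) by apply/valid_word_rcons.
    by move=> /(_ vui); apply/negP; rewrite -leNgt (le_trans ir)// ltW.
  have S0 : 0 <= \sum_(w <- words m n | prefix u w) powR (D 0 w) t.
    by apply: sumr_ge0 => v _; exact: powR_ge0.
  move=> h; have := le_trans (ler_wpM2r S0 ZM') h.
  rewrite powRM ?(mulr_ge0 (ltW K0) (ltW kap0)) ?(ltW r0)// => h'.
  have -> : B0 * powR r t / M * Zfrom 0 n t = M^-1 * (B0 * powR r t * Zfrom 0 n t) by ring.
  rewrite ler_pdivlMl//; apply: le_trans h' _; rewrite le_eqVlt /B0.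
  by apply/orP; left; apply/eqP; ring.
apply: (@le_trans _ _ (\sum_(u <- P) \sum_(w <- words m n | prefix u w) powR (D 0 w) t)).
  rewrite (exchange_big_dep xpredT)//= [leLHS]big_mkcond/=.
  apply: ler_sum_mem => w wn.
  case: ifP => mw; last by apply: sumr_ge0 => u _; exact: powR_ge0.
  have uP : take (cut r w) w \in P.
    by rewrite mem_undup; apply/map_f; rewrite mem_filter mw wn.
  have pw : prefix (take (cut r w) w) w.
    by apply/prefixP; exists (drop (cut r w) w); rewrite cat_take_drop.
  rewrite big_mkcond (bigD1_seq _ uP (undup_uniq _))/= pw lerDl.
  by apply: sumr_ge0 => u _; case: ifP => // _; exact: powR_ge0.
apply: (@le_trans _ _ (\sum_(u <- P) B0 * powR r t / M * Zfrom 0 n t)).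
  by apply: ler_sum_mem => u; exact: cyl.
rewrite big_const_seq count_predT iter_addr_0 -[leLHS]mulr_natl.
have -> : (N%:R * B0 + 1) / M * powR r t * Zfrom 0 n t =
  (N%:R * B0 + 1) * (powR r t / M * Zfrom 0 n t) by ring.
have -> : (size P)%:R * (B0 * powR r t / M * Zfrom 0 n t) =
  (size P)%:R * B0 * (powR r t / M * Zfrom 0 n t) by ring.
apply: ler_wpM2r; first by rewrite mulr_ge0 ?divr_ge0 ?powR_ge0 ?ltW.
by rewrite (le_trans (ler_wpM2r B00 (_ : _ <= N%:R)))// ?ler_nat// lerDl.
Qed.

(** * From covers of the limit set to covers of a level *)

Definition level n : set pt :=
  \bigcup_(w in [set w | w \in words m n]) (comp_from phi 0 w @` X).

Lemma level_closed n : closed (level n).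
Proof.
apply: closed_bigcup; first exact: finite_seq.
move=> w /= /mem_words0[_ vw]; apply: compact_closed; first exact: norm_hausdorff.
apply: continuous_compact => //; apply: continuous_in_subspaceT => x /set_mem /XV Vx.
by have [[/differentiable_continuous]] := dword_bounds vw Vx.
Qed.

Lemma level_decr n n' : (n <= n')%N -> level n' `<=` level n.
Proof.
move=> nn' _ [w /mem_words0[sw vw] [x Xx <-]].
have vw' := vw; rewrite -(cat_take_drop n w) in vw'.
have /valid_word_cat[vt vd] := vw'.
have st : size (take n w) = n by rewrite size_takel// sw.
exists (take n w); first by apply/mem_words0.
exists (comp_from phi (0 + size (take n w)) (drop n w) x).
  by apply: (comp_from_X vd); exists x.
by have := comp_from_cat 0 (take n w) (drop n w); rewrite cat_take_drop => ->.
Qed.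

(** The sets [G n] are open and cover [X]: a point is either in the limit set, hence in some [O k],
    or outside some level. In a finite subcover, points of a deep level cannot lie in the
    complements, so they lie in one of finitely many [O k]. *)
Lemma level_cover (O : nat -> set pt) : (forall k, open (O k)) ->
  limit_set X phi m `<=` \bigcup_k O k ->
  exists N, forall n, (N <= n)%N -> forall w, w \in words m n ->
    exists2 k, (k < N)%N & (comp_from phi 0 w @` X) `&` O k !=set0.
Proof.
move=> oO JO.
pose G n := \bigcup_(k in [set k | (k < n)%N]) O k `|` ~` level n.
have := cX; rewrite compact_cover => /(_ nat setT G)[].
- move=> n _; apply: openU; first by apply: bigcup_open => k _.
  by rewrite openC; exact: level_closed.
- move=> x Xx; have [Jx|nJx] := pselect (limit_set X phi m x).
    have [k _ Okx] := JO x Jx; exists k.+1 => //; left; by exists k => /=.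
  have [n nx] : exists n, ~ level n x.
    by apply: contrapT => /forallNP h; apply: nJx => n _; apply: contrapT => /h.
  by exists n => //; right.
move=> D' _ XG; exists (\max_(i <- finmap.enum_fset D') i) => n Nn w wn.
have /mem_words0[sw vw] := wn; have [x Xx] := X0.
have Xy : X (comp_from phi 0 w x) by apply: (comp_from_X vw); exists x.
have [i iD' Gi] := XG _ Xy.
have iN : (i <= \max_(i <- finmap.enum_fset D') i)%N by apply: leq_bigmax_seq.
case: Gi => [[k /= ki Ok]|]; last first.
  case; apply: level_decr (leq_trans iN Nn) _ _.
  by exists w => //; exists x.
exists k; first exact: leq_trans ki iN.
by exists (comp_from phi 0 w x); split=> //; exists x.
Qed.

(** The exponent 0 is set apart because the power is then 1 at every radius. *)
Let small_radius (t e delta : R) : 0 <= t -> 0 < e -> 0 < delta ->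
  exists2 s : R, 0 < s < delta & t = 0 \/ powR s t <= e.
Proof.
move=> t0 e0 del0; have [->|tn0] := eqVneq t 0.
  exists (delta / 2); last by left.
  by rewrite divr_gt0// ltr_pdivrMr// ltr_pMr// ltr1n.
have tp : 0 < t by rewrite lt_neqAle eq_sym tn0.
have p0 : 0 < powR e t^-1 by rewrite powR_gt0.
exists (Num.min (powR e t^-1) (delta / 2)).
  rewrite lt_min p0 divr_gt0//= gt_min; apply/orP; right.
  by rewrite ltr_pdivrMr// ltr_pMr// ltr1n.
right; apply: (@le_trans _ _ (powR (powR e t^-1) t)).
  apply: ge0_ler_powR => //; rewrite ?nnegrE ?(ltW p0)//.
    by rewrite le_min (ltW p0) divr_ge0// ltW.
  by rewrite ge_min lexx.
by rewrite -powRrM mulVf// powRr1// ltW.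
Qed.

Definition hits (O : set pt) (w : seq nat) : bool :=
  `[< (comp_from phi 0 w @` X) `&` O !=set0 >].

(** The set is thickened to an open ball centred at one of its points, at the price of the factor
    [powR 2 t] and an additive error [e]. *)
Lemma set_mass (t B M delta : R) : 0 <= t -> 0 < B -> 0 < M -> 0 < delta ->
  (forall (o : pt) (r : R), 0 < r < delta ->
    exists n1 : nat, forall n, (n1 <= n)%N ->
      \sum_(w <- words m n | meets o r w) powR (D 0 w) t
      <= B / M * powR r t * Zfrom 0 n t) ->
  forall (U : set pt) (e : R), 0 < e -> (ediam U <= (delta / 4)%:E)%E ->
  exists O : set pt, exists n1 : nat, [/\ open O, U `<=` O &
    forall n, (n1 <= n)%N -> \sum_(w <- words m n | hits O w) powR (D 0 w) t
      <= B / M * powR 2 t * (fine (hcontent t U) + e) * Zfrom 0 n t].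
Proof.
move=> t0 B0 M0 del0 mass U e e0 Udel.
have BM0 : 0 < B / M by rewrite divr_gt0.
have [->|/set0P[u Uu]] := eqVneq U set0.
  exists set0, 0%N; split; [exact: open0|by []|move=> n _].
  rewrite big1; last by move=> w /asboolP[x []].
  rewrite hcontent0 /= add0r; apply: mulr_ge0; last exact/ltW/Zfrom_gt0.
  by apply: mulr_ge0; [apply: mulr_ge0; [exact: ltW|exact: powR_ge0]|exact: ltW].
have [fU D0 Dd UD] := ediam_bounds Uu Udel.
rewrite hcontentE; last by exists u.
set diam := fine (ediam U) in D0 Dd UD *.
have [s /andP[s0 sdel] ts] := small_radius t0 e0 del0.
(* Doubling makes the ball strictly larger than the diameter; [s] takes over when the diameter is
   zero or tiny, and its power is absorbed in [e]. *)
pose r := Num.max (2 * diam) s.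
have rs : s <= r by rewrite le_max lexx orbT.
have r0 : 0 < r by exact: lt_le_trans rs.
have rdel : r < delta by rewrite gt_max sdel andbT; lra.
have Dr : diam < r.
  rewrite lt_max; have [->|dn0] := eqVneq diam 0; first by rewrite s0 orbT.
  have : 0 < diam by rewrite lt_neqAle eq_sym dn0.
  by move=> dp; rewrite ltr_pMl// ltr1n.
have rt : powR r t <= powR 2 t * (powR diam t + e).
  have p2 : 1 <= powR 2 t.
    have h12 : 1 <= 2 :> R by rewrite ler1n.
    by have := ler_powR h12 t0; rewrite powRr0.
  case: ts => [tE|ts].
    by rewrite tE !powRr0 mul1r lerDl ltW.
  rewrite /r; case: (leP (2 * diam) s) => _.
    apply: le_trans ts _; apply: (@le_trans _ _ (1 * e)); first by rewrite mul1r.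
    apply: ler_pM; rewrite ?(ltW e0)//.
    by rewrite lerDr powR_ge0.
  rewrite powRM// ler_wpM2l ?powR_ge0//.
  by rewrite lerDl ltW.
have [|n1 Hn1] := mass u r; first by rewrite r0.
exists (ball u r), n1; split; first exact: ball_open.
  by move=> v /UD uv; apply/ball_rVE; exact: le_lt_trans uv Dr.
move=> n /Hn1 h; apply: (@le_trans _ _ (\sum_(w <- words m n | meets u r w) powR (D 0 w) t)).
  rewrite [leLHS]big_mkcond [leRHS]big_mkcond; apply: ler_sum => w _.
  case: ifP => [/asboolP[_ [[x Xx <-] /ball_rVE ux]]|_]; last first.
    by case: ifP => // _; exact: powR_ge0.
  case: ifP => // /negP; case; apply/asboolP; exists x => //.
  by rewrite distrC ltW.
apply: le_trans h _; rewrite ler_wpM2r ?(ltW (Zfrom_gt0 _ _ _))//.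
by rewrite -[leRHS]mulrA ler_wpM2l// ltW.
Qed.

(** * Lower and upper bounds for the Hausdorff measure *)

Let sum_half (e : R) N : \sum_(k < N) e / 2 ^+ k.+1 = e - e / 2 ^+ N.
Proof.
elim: N => [|N IH]; first by rewrite big_ord0 expr0 divr1 subrr.
by rewrite big_ord_recr /= IH exprS; field; rewrite expf_neq0.
Qed.

Lemma hausdorff_lower (t : R) : 0 <= t -> exists2 B : R, 0 < B &
  forall (M : R) (k0 : nat), 0 < M -> (forall k, (k0 <= k)%N -> M <= Zfrom 0 k t) ->
  ((M / B)%:E <= hausdorff_measure t (limit_set X phi m))%E.
Proof.
move=> t0; have [B B0 HB] := ball_mass t0.
have p20 : 0 < powR (2 : R) t by rewrite powR_gt0.
exists (B * powR 2 t); first by rewrite mulr_gt0.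
move=> M k0 M0 ZM; have [delta del0 mass] := HB M k0 M0 ZM.
have smass := set_mass t0 B0 M0 del0 mass.
apply: (@le_trans _ _ (hausdorff_delta t (delta / 4) (limit_set X phi m))); last first.
  by apply: ereal_sup_ubound; exists (delta / 4) => //=; rewrite divr_gt0.
apply: le_ereal_inf_tmp => _ [U [JU Udel] <-].
apply/lee_addgt0Pr => e e0.
have ek0 (k : nat) : 0 < e / 2 ^+ k.+1 by rewrite divr_gt0// exprn_gt0.
have /choice[W /choice[n1 HO]] : forall k, exists O : set pt, exists n1 : nat,
    [/\ open O, U k `<=` O &
    forall n, (n1 <= n)%N -> \sum_(w <- words m n | hits O w) powR (D 0 w) t
      <= B / M * powR 2 t * (fine (hcontent t (U k)) + e / 2 ^+ k.+1) * Zfrom 0 n t].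
  by move=> k; exact: smass (ek0 k) (Udel k).
have [|x Jx|N HN] := @level_cover W.
- by move=> k; have [] := HO k.
- by have [k _ Ux] := JU x Jx; exists k => //; have [_ + _] := HO k; apply.
(* One level deep enough for the finite cover and for the mass estimates of the first [N] sets.
   Every word of length [n] is then counted at least once, and [Zfrom 0 n t] cancels. *)
pose n := maxn N (\max_(k < N) n1 k).
have Zn0 := Zfrom_gt0 0 n t.
have Zle : Zfrom 0 n t <= \sum_(k < N) \sum_(w <- words m n | hits (W k) w) powR (D 0 w) t.
  rewrite (exchange_big_dep xpredT)//= [leLHS]Zfrom0; apply: ler_sum_mem => w wn.
  have [k kN hk] := HN n (leq_maxl _ _) w wn.
  rewrite (bigD1 (Ordinal kN))/=; last exact/asboolP.
  by rewrite lerDl; apply: sumr_ge0 => i _; exact: powR_ge0.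
have Zle2 : Zfrom 0 n t <= \sum_(k < N)
    B / M * powR 2 t * (fine (hcontent t (U k)) + e / 2 ^+ k.+1) * Zfrom 0 n t.
  apply: le_trans Zle _; apply: ler_sum => k _; have [_ _] := HO k; apply.
  by apply: leq_trans (leq_maxr _ _); exact: (leq_bigmax k).
rewrite -mulr_suml -mulr_sumr big_split/= sum_half in Zle2.
have Mle : M / (B * powR 2 t) <= \sum_(k < N) fine (hcontent t (U k)) + e.
  rewrite ler_pdivrMr ?mulr_gt0//.
  rewrite -[leLHS]mul1r -ler_pdivlMr//.
  have : 1 <= B / M * powR 2 t * (\sum_(k < N) fine (hcontent t (U k)) + (e - e / 2 ^+ N)).
    by rewrite -(ler_pM2r Zn0) mul1r.
  move=> /le_trans; apply.
  have -> : B / M * powR 2 t * (\sum_(k < N) fine (hcontent t (U k)) + (e - e / 2 ^+ N)) =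
    (\sum_(k < N) fine (hcontent t (U k)) + (e - e / 2 ^+ N)) * (B * powR 2 t) / M by ring.
  rewrite ler_pM2r ?invr_gt0// ler_pM2r ?mulr_gt0// lerD2l gerBl.
  by rewrite divr_ge0 ?exprn_ge0// ltW.
apply: (@le_trans _ _ (\sum_(k < N) fine (hcontent t (U k)) + e)%:E).
  by rewrite lee_fin.
rewrite EFinD leeD2r// -sumEFin.
rewrite (eq_bigr (fun k : 'I_N => hcontent t (U k))); last first.
  by move=> k _; rewrite fineK// hcontent_fin.
rewrite -(big_mkord xpredT (fun k => hcontent t (U k))).
by apply: nneseries_lim_ge => k _ _; exact: hcontent_ge0.
Qed.

Lemma hausdorff_upper (t : R) : 0 <= t -> exists2 C : R, 0 < C &
  (hausdorff_measure t (limit_set X phi m) <=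
    C%:E * limn_einf (fun n => (Zfrom 0 n t)%:E))%E.
Proof.
move=> t0; have [C C0 HC] := word_diameter.
pose C' := d%:R * C; have C'0 : 0 < C' by rewrite mulr_gt0.
have Ct0 : 0 < powR C' t by rewrite powR_gt0.
exists (powR C' t) => //.
apply: ge_ereal_sup => _ [delta /= del0 <-].
rewrite -lee_pdivrMl//.
have wdiam w : valid_word m 0 w -> (ediam (comp_from phi 0 w @` X) <= (C' * D 0 w)%:E)%E.
  move=> vw; apply: ge_ereal_sup => _ [_ [x Xx <-] [_ [y Xy <-] <-]].
  rewrite lee_fin (le_trans (enorm_le_norm _))// -mulrA ler_wpM2l//.
  exact: (HC 0%N w vw y x Xy Xx).
(* From [n0] on, the images of level [n] are admissible for [delta]; the bound holds for each such
   [n] and so passes to the lower limit. *)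
have [n0 Hn0] : exists n0, forall n, (n0 <= n)%N -> C' * eta ^+ n <= delta.
  have dC : 0 < delta / C' by rewrite divr_gt0.
  have /cvgrPdist_le/(_ _ dC)[n1 _ Hn1] : eta ^+ n @[n --> \oo] --> (0 : R).
    by apply: cvg_expr; rewrite gtr0_norm ?eta_gt0.
  exists n1 => n /Hn1; rewrite sub0r normrN gtr0_norm ?exprn_gt0 ?eta_gt0//.
  by rewrite ler_pdivlMr// mulrC.
apply: (le_limn_einf (n0 := n0)) => n n0n.
rewrite lee_pdivrMl//.
pose s := words m n.
(* The finite cover is padded with empty sets, whose content is 0 even for exponent 0. *)
pose U k : set pt := if (k < size s)%N then comp_from phi 0 (nth [::] s k) @` X else set0.
have valid_nth k : (k < size s)%N -> size (nth [::] s k) = n /\ valid_word m 0 (nth [::] s k).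
  by move=> ks; apply/mem_words0; exact: mem_nth.
apply: (@le_trans _ _ (\sum_(0 <= k <oo) hcontent t (U k))%E).
  apply: ereal_inf_lbound; exists U => //; split.
    move=> x /(_ n I)[w /= wn wx]; exists (index w s) => //.
    by rewrite /U index_mem wn nth_index.
  move=> k; rewrite /U; case: ifP => [/valid_nth[sk vk]|_].
    apply: le_trans (wdiam _ vk) _; rewrite lee_fin (le_trans _ (Hn0 n n0n))//.
    by rewrite ler_wpM2l ?(ltW C'0)// -sk Dword_le_eta.
  apply: ge_ereal_sup => _ [x []].
rewrite (nneseries_split 0 (size s)); last by move=> k _; exact: hcontent_ge0.
rewrite [X in (_ + X)%E]eseries0 ?adde0; last first.
  by move=> k; rewrite add0n /U leqNgt => /negbTE -> _; exact: hcontent0.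
rewrite add0n Zfrom0 -EFinM mulr_sumr -/s (big_nth [::]) -sumEFin.
rewrite big_nat [leRHS]big_nat; apply: lee_sum => k /andP[_ ks].
have [sk vk] := valid_nth k ks; rewrite /U ks.
have [x Xx] := X0; have yU : (comp_from phi 0 (nth [::] s k) @` X)
  (comp_from phi 0 (nth [::] s k) x) by exists x.
have [_ f0 fC _] := ediam_bounds yU (wdiam _ vk).
have Dk := ltW (Dword_gt0 vk).
rewrite hcontentE; last by eexists; exact: yU.
rewrite lee_fin -powRM// ?(ltW C'0)//.
by apply: ge0_ler_powR; rewrite ?nnegrE ?mulr_ge0// ltW.
Qed.

End System.

(** * The trichotomy at the critical exponent *)

Lemma Bdim_ge0 (R : realType) (d : nat) (X : set 'rV[R]_d)
  (phi : nat -> nat -> 'rV[R]_d -> 'rV[R]_d) (m : nat -> nat) : 0 <= Bdim X phi m.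
Proof.
rewrite /Bdim; set S := [set t | _].
(* For an empty or unbounded set [sup] takes the default value 0. *)
have [supS|nS] := pselect (has_sup S); last by rewrite sup_out.
have [t St] := supS.1; apply: le_trans St.1 _; exact: (ub_le_sup supS.2 St).
Qed.

(** The upper bound carries finiteness and vanishing from [L] to [H], the lower bound carries
    infinity and positivity. The middle case follows by exclusion. *)
Lemma trichotomy_of_bounds (R : realType) (L H : \bar R) (B C : R) :
  0 < B -> 0 < C -> (0 <= L)%E -> (0 <= H)%E -> (H <= C%:E * L)%E ->
  (forall M : R, 0 < M -> (M%:E < L)%E -> ((M / B)%:E <= H)%E) ->
  [/\ (L = +oo)%E <-> (H = +oo)%E,
      (0 < L < +oo)%E <-> (0 < H < +oo)%E &
      (L = 0)%E <-> (H = 0)%E].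
Proof.
move=> B0 C0 L0 H0 up low.
have Ly : (L = +oo)%E <-> (H = +oo)%E.
  split=> [LE|HE].
    apply/eqyP => A A0; have := low (A * B) (mulr_gt0 A0 B0).
    by rewrite LE ltry mulfK ?gt_eqF// => /(_ isT).
  case: L L0 up {low} => [r||]//= _; rewrite HE -EFinM leye_eq//.
have Lz : (L = 0)%E <-> (H = 0)%E.
  split=> [LE|HE].
    by apply/eqP; rewrite eq_le H0 andbT; move: up; rewrite LE mule0.
  apply/eqP; rewrite eq_le L0 andbT leNgt; apply/negP => Lgt0.
  have [M M0 ML] : exists2 M : R, 0 < M & (M%:E < L)%E.
    case: L Lgt0 {L0 up low Ly} => [r||]//= Lgt0; last by exists 1; rewrite ?ltry.
    exists (r / 2); rewrite ?lte_fin ?divr_gt0//.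
    by rewrite ltr_pdivrMr// ltr_pMr ?ltr1n.
  have := low M M0 ML; rewrite HE lee_fin; apply/negP; rewrite -ltNge.
  exact: divr_gt0.
split=> //; rewrite !lt0e !ltey L0 H0 !andbT.
split=> /andP[/eqP z /eqP y]; apply/andP; split; apply/eqP => E.
- by apply: z; exact/Lz.
- by apply: y; exact/Ly.
- by apply: z; exact/Lz.
- by apply: y; exact/Ly.
Qed.

Theorem theorem7p1 (R : realType) (d : nat) (X : set 'rV[R]_d)
    (phi : nat -> nat -> 'rV[R]_d -> 'rV[R]_d) (m : nat -> nat) :
  (0 < d)%N ->
  admissible_X X ->
  is_NCIFS X phi m ->
  balanced X phi m ->
  uniformly_finite m ->
  let h := Bdim X phi m in
  let L := limn_einf (fun n => (Zn X phi m n h)%:E) in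
  let H := hausdorff_measure h (limit_set X phi m) in
  [/\ (L = +oo)%E <-> (H = +oo)%E,
      (0 < L < +oo)%E <-> (0 < H < +oo)%E &
      (L = 0)%E <-> (H = 0)%E].
Proof.
move=> d0 adm [m0 phiX osc [V [oV coV XV cphi [K K1 distK]]] [eta eta1 phi_eta]].
move=> [kappa kappa1 bal] [q mq] h L H.
have h0 : 0 <= h := Bdim_ge0 X phi m.
have cork := admissible_corkscrew adm; have [X0 cX _ _] := adm.
have cphi' j i : (i < m j)%N -> conformal_map V (phi j i).
  by move=> /cphi[inj fV df _ cf]; split.
have dist k w : valid_word m k w -> distortion V K (comp_from phi k w).
  (* The empty word gives the identity, with derivative norm 1, and [1 <= K]. *)
  move=> vw x y Vx Vy; have [->|wn] := eqVneq w [::]; last exact: distK vw wn x y Vx Vy.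
  by rewrite !(dnorm_id d0) mulr1.
have [B B0 low] := hausdorff_lower d0 X0 XV K1 m0 phiX osc cphi' dist phi_eta
  cX oV cork eta1 kappa1 mq bal h0.
have [C C0 up] := hausdorff_upper d0 X0 XV K1 m0 phiX cphi' dist phi_eta
  cX oV coV eta1 h0.
apply: (trichotomy_of_bounds B0 C0) => //.
- apply: (le_limn_einf (n0 := 0)) => n _.
  by rewrite lee_fin Zn_Zfrom; exact/ltW/(Zfrom_gt0 d0 X0 XV m0 cphi' dist).
- exact: hausdorff_measure_ge0.
- move=> M M0 /lt_limn_einf[n0 Hn0]; apply: (low M n0 M0) => k /Hn0.
  by rewrite lee_fin.
Qed.
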